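(* Let $\mathbb{F}$ be a field. Up to isomorphism there are exactly three nilpotent symplectic alternating algebras $L$ over $\mathbb{F}$ of dimension $10$ that have an isotropic centre of dimension $3$ and where $\dim L^{3}=5$. These are given by the presentations: $$\mathcal{P}_{10}^{(3,1)}:\ (x_{1}y_{3},y_{5})=1,\ (x_{2}y_{4},y_{5})=1,\ (y_{1}y_{2},y_{5})=1;$$ $$\mathcal{P}_{10}^{(3,2)}:\ (x_{2}y_{4},y_{5})=1,\ (x_{1}y_{3},y_{5})=1,\ (y_{1}y_{2},y_{5})=1,\ (y_{2}y_{3},y_{4})=1;$$ $$\mathcal{P}_{10}^{(3,3)}:\ (x_{2}y_{4},y_{5})=1,\ (x_{1}y_{3},y_{4})=1,\ (y_{1}y_{2},y_{5})=1.$$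
   Context: A symplectic alternating algebra (SAA) over a field $\mathbb{F}$ is a finite-dimensional $\mathbb{F}$-vector space $L$ with a non-degenerate alternating bilinear form $(\ ,\ )$ and a bilinear alternating product $L\times L\to L$, $(x,y)\mapsto xy$ (so $xx=0$), such that $(xy,z)=(yz,x)$ for all $x,y,z\in L$. It follows that $(x,y,z)\mapsto (xy,z)$ is an alternating trilinear form. Isomorphisms of SAAs are linear bijections preserving the form and the product. The lower central series is $L^1=L$, $L^{k+1}=L^k L$, where $AB$ denotes the linear span of all products $ab$ with $a\in A,b\in B$. $L$ is nilpotent if $L^{k}=0$ for some $k$. The centre is $Z(L)=\{x\in L: xy=0 \text{ for all } y\in L\}$. A subspace is isotropic if the form vanishes identically on it. A standard basis of a $10$-dimensional SAA is a basis $x_1,y_1,\ldots,x_5,y_5$ with $(x_i,x_j)=(y_i,y_j)=0$ and $(x_i,y_j)=\delta_{ij}$ for all $i,j$. A presentation lists values of triples $(uv,w)$ with $u,v,w$ distinct elements of a standard basis; the convention is that all triple values of basis elements not listed (and not determined from the listed ones by the alternating property) are $0$. Such data determine the product, hence the SAA, uniquely. *)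

(* Defs.v *)
From HB Require Import structures.
From mathcomp Require Import all_boot all_order all_algebra.

Set Implicit Arguments.
Unset Strict Implicit.
Unset Printing Implicit Defensive.

Import GRing.Theory.
Local Open Scope ring_scope.

Record saa (F : fieldType) := SAA {
  saa_sort :> vectType F;
  sform : {bilinear saa_sort -> saa_sort -> F | *%R & *%R};
  smul : {bilinear saa_sort -> saa_sort -> saa_sort};
  sform_alt : forall x, sform x x = 0;
  sform_nondeg : forall x, (forall y, sform x y = 0) -> x = 0;
  smul_alt : forall x, smul x x = 0;
  sform_smul : forall x y z, sform (smul x y) z = sform (smul y z) x
}.

Arguments sform {F s}.
Arguments smul {F s}.

Section Theory.
Variables (F : fieldType) (L : saa F).

(* By bilinearity the products of basis vectors already span; see sprodvP. *)
Definition sprodv (A B : {vspace L}) : {vspace L} :=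
  <<[seq smul a b | a <- vbasis A, b <- vbasis B]>>%VS.

Lemma memv_smul (A B : {vspace L}) a b :
  a \in A -> b \in B -> smul a b \in sprodv A B.
Proof.
move=> /coord_vbasis-> /coord_vbasis->.
rewrite linear_sumlz; apply: memv_suml => i _.
rewrite linear_sumr; apply: memv_suml => j _.
rewrite linearZl_LR linearZr_LR; do 2!apply: memvZ.
by apply/memv_span/allpairs_f; apply: mem_nth; rewrite size_tuple.
Qed.

Lemma sprodvP (A B C : {vspace L}) :
  reflect (forall a b, a \in A -> b \in B -> smul a b \in C)
          (sprodv A B <= C)%VS.
Proof.
apply: (iffP idP) => [sABC a b Aa Bb | sABC].
  exact: (subvP sABC) (memv_smul Aa Bb).
apply/span_subvP => _ /allpairsP[[a b] /= [Aa Bb ->]].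
by apply: sABC; apply: vbasis_mem.
Qed.

(* Indexed from 1 as usual: lcs 1 = L and lcs k.+1 = (lcs k) L for k >= 1
   (and lcs 0 = L is a dummy value). *)
Definition lcs (k : nat) : {vspace L} :=
  iter k.-1 (fun A => sprodv A fullv) fullv.

Definition nilpotent := exists k, lcs k = 0%VS.

Definition centre : {vspace L} := lker (linfun (fun x : L => linfun (smul x))).

Lemma centreP x : reflect (forall y, smul x y = 0) (x \in centre).
Proof.
have lin : linear (fun x : L => linfun (smul x)).
  move=> a u v; apply/lfunP => y.
  by rewrite add_lfunE scale_lfunE !lfunE /= linearPl.
pose h := GRing.isLinear.Build _ _ _ _ _ lin.
pose f : {linear L -> 'Hom(L, L)} := HB.pack (fun x : L => linfun (smul x)) h.
rewrite memv_ker -[linfun _]/(linfun f) lfunE /=.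
apply: (iffP eqP) => [x0 y | x0].
  by have /lfunP/(_ y) := x0; rewrite zero_lfunE lfunE.
by apply/lfunP => y; rewrite zero_lfunE lfunE /= x0.
Qed.

Definition isotropic (A : {vspace L}) :=
  forall a b, a \in A -> b \in A -> sform a b = 0.

(* Index set of a standard basis of a 2n-dimensional algebra:
   inl i stands for x_i and inr i for y_i. *)
Definition standard_basis n (e : 'I_n + 'I_n -> L) :=
  [/\ basis_of fullv (codom e),
      forall i j, sform (e (inl i)) (e (inl j)) = 0,
      forall i j, sform (e (inr i)) (e (inr j)) = 0
    & forall i j, sform (e (inl i)) (e (inr j)) = (i == j)%:R].

(* A presentation is the list of the triples (u, v, w) with (uv, w) = 1. *)
Definition presented_by n (P : seq (('I_n + 'I_n) * ('I_n + 'I_n) * ('I_n + 'I_n))) :=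
  exists e : 'I_n + 'I_n -> L,
  [/\ standard_basis e,
      forall u v w, (u, v, w) \in P -> sform (smul (e u) (e v)) (e w) = 1
    & forall u v w,
        (forall u' v' w', (u', v', w') \in P ->
           ~~ perm_eq [:: u; v; w] [:: u'; v'; w']) ->
        sform (smul (e u) (e v)) (e w) = 0].

End Theory.

Definition saa_iso (F : fieldType) (L M : saa F) :=
  exists f : {linear L -> M},
  [/\ bijective f,
      forall u v, sform (f u) (f v) = sform u v
    & forall u v, f (smul u v) = smul (f u) (f v)].

(* Basis symbols x_1, ..., x_5, y_1, ..., y_5, numbered from 1. *)
Definition x_ (k : nat) : 'I_5 + 'I_5 := inl (inord k.-1).
Definition y_ (k : nat) : 'I_5 + 'I_5 := inr (inord k.-1).

Definition P10_3_1 :=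
  [:: (x_ 1, y_ 3, y_ 5); (x_ 2, y_ 4, y_ 5); (y_ 1, y_ 2, y_ 5)].

Definition P10_3_2 :=
  [:: (x_ 2, y_ 4, y_ 5); (x_ 1, y_ 3, y_ 5); (y_ 1, y_ 2, y_ 5);
      (y_ 2, y_ 3, y_ 4)].

Definition P10_3_3 :=
  [:: (x_ 2, y_ 4, y_ 5); (x_ 1, y_ 3, y_ 4); (y_ 1, y_ 2, y_ 5)].

Definition in_class (F : fieldType) (L : saa F) :=
  [/\ \dim {:L} = 10, nilpotent L, isotropic (centre L),
      \dim (centre L) = 3 & \dim (lcs L 3) = 5]%N.

(* Main.v *)
Require Import Defs.
From HB Require Import structures.
From mathcomp Require Import all_boot all_order all_algebra.
From mathcomp Require Import ring.

Set Implicit Arguments.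
Unset Strict Implicit.
Unset Printing Implicit Defensive.

Import GRing.Theory.
Local Open Scope ring_scope.

(** Everything is read off the alternating trilinear form T(u,v,w) = (uv,w),
written [tri] below, and the chain Z <= R <= N <= L where Z is the centre,
R = L^3 and N = L^2. Since N is the orthogonal of Z, it has dimension 7, and
the orthogonal of R, of dimension 5, consists of the x with T(x,N,L) = 0.

Structure. Nilpotency is used through one fact, [lcs_stable]: L^k cannot lie
in L^(k+1) + Z unless L^(k+1) = 0. It forces the orthogonal of R into N
([orthR_leN]), and then R to be isotropic, hence equal to its orthogonal
([orthR]). So T(R,N,L) = 0. As N/R is a plane, T vanishes on N x N x N, and
T(y1,y2,-), for y1, y2 spanning N modulo R, is a nonzero linear form on L; its
kernel H contains N and is a hyperplane.

Trichotomy. On H x H x N the form T only depends on the classes modulo N of its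
first two arguments. Since H/N is a plane, T induces there a linear form on N,
well defined up to a scalar. It is zero, or nonzero but zero on R, or nonzero
on R, and these three cases are the three presentations.

Normal forms. In each case suitable x1, x2 in R, y1, y2 in N, y3, y4 in H and
y5 outside H give T the prescribed values ([presented_by_NHH0],
[presented_by_RHH0], [presented_by_RHH]). The form T does not see Z, and Z is
dual to L/N, so corrections by central elements complete any such vectors to a
standard basis with the same values of T ([lift_frame]). Only linear equations
are solved and nonzero scalars inverted, so the field is arbitrary.

Existence. A presentation is realised on coordinate vectors, T being a sum of
3 x 3 minors ([model]), and it determines the algebra up to isomorphism
([presented_iso]). The vanishing of T on H x H x N, and on H x H x R, can be
stated with products alone, so isomorphisms preserve it; this separates the
three models. *)

(** * The alternating triple product *)
Section TripleProduct.
Variables (F : fieldType) (L : saa F).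
Implicit Types u v w x y z : L.

Lemma sformC u v : sform u v = - sform v u.
Proof.
have := sform_alt (u + v).
rewrite !(linearDl, linearDr) !sform_alt add0r addr0 => /eqP.
by rewrite addr_eq0 => /eqP <-; rewrite ?opprK.
Qed.

Lemma sform_eq u v : (forall w, sform u w = sform v w) -> u = v.
Proof.
move=> uv; apply/eqP; rewrite -subr_eq0; apply/eqP/sform_nondeg => w.
by rewrite linearBl uv subrr.
Qed.

Definition tri u v w : F := sform (smul u v) w.

Lemma triDl u u' v w : tri (u + u') v w = tri u v w + tri u' v w.
Proof. by rewrite /tri !linearDl. Qed.
Lemma triDm u v v' w : tri u (v + v') w = tri u v w + tri u v' w.
Proof. by rewrite /tri linearDr linearDl. Qed.
Lemma triDr u v w w' : tri u v (w + w') = tri u v w + tri u v w'.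
Proof. by rewrite /tri linearDr. Qed.
Lemma triZl a u v w : tri (a *: u) v w = a * tri u v w.
Proof. by rewrite /tri !linearZl_LR. Qed.
Lemma triZm a u v w : tri u (a *: v) w = a * tri u v w.
Proof. by rewrite /tri linearZr_LR linearZl_LR. Qed.
Lemma triZr a u v w : tri u v (a *: w) = a * tri u v w.
Proof. by rewrite /tri linearZr_LR. Qed.
Lemma triNl u v w : tri (- u) v w = - tri u v w.
Proof. by rewrite /tri !linearNl. Qed.
Lemma triNm u v w : tri u (- v) w = - tri u v w.
Proof. by rewrite /tri linearNr linearNl. Qed.
Lemma triNr u v w : tri u v (- w) = - tri u v w.
Proof. by rewrite /tri linearNr. Qed.
Definition triE :=
  ((triDl, triDm, triDr), (triZl, triZm, triZr), (triNl, triNm, triNr)).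
Definition sformE := (@linearDl _ _ _ _ _ _ (@sform F L),
  @linearDr _ _ _ _ _ _ (@sform F L), @linearZl_LR _ _ _ _ _ _ (@sform F L),
  @linearZr_LR _ _ _ _ _ _ (@sform F L), @linearNl _ _ _ _ _ _ (@sform F L),
  @linearNr _ _ _ _ _ _ (@sform F L)).

Lemma tri_cycle u v w : tri u v w = tri v w u.
Proof. exact: sform_smul. Qed.
Lemma tri_swap u v w : tri u v w = - tri v u w.
Proof.
have := smul_alt (u + v); rewrite !(linearDl, linearDr) !smul_alt add0r addr0.
by move/eqP; rewrite addr_eq0 /tri => /eqP ->; rewrite linearNl.
Qed.
Lemma tri_swapr u v w : tri u v w = - tri u w v.
Proof. by rewrite tri_cycle tri_swap -tri_cycle. Qed.
Lemma tri_uuw u w : tri u u w = 0.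
Proof. by rewrite /tri smul_alt linear0l. Qed.
Lemma tri_uww u w : tri u w w = 0.
Proof. by rewrite tri_cycle tri_uuw. Qed.
Lemma tri_uwu u w : tri u w u = 0.
Proof. by rewrite tri_cycle tri_uww. Qed.
Definition tri_alt := (tri_uuw, tri_uww, tri_uwu).

Lemma centre_tri x : reflect (forall y z, tri x y z = 0) (x \in centre L).
Proof.
apply: (iffP (centreP x)) => [x0 y z | x0 y]; first by rewrite /tri x0 linear0l.
by apply: sform_nondeg => z; apply: x0.
Qed.

(** The values on bases decide whether T vanishes, so the case distinctions of
the classification are constructive. *)
Lemma tri_dec (A B C : {vspace L}) :
  (forall a b c, a \in A -> b \in B -> c \in C -> tri a b c = 0) \/
  (exists a b c, [/\ a \in A, b \in B, c \in C & tri a b c != 0]).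
Proof.
have nthV (U : {vspace L}) (i : 'I_(\dim U)) : (vbasis U)`_i \in U.
  by rewrite vbasis_mem // mem_nth // size_tuple.
have [t0 | ] := boolP [forall i : 'I_(\dim A), forall j : 'I_(\dim B),
  forall k : 'I_(\dim C), tri (vbasis A)`_i (vbasis B)`_j (vbasis C)`_k == 0].
  left=> a b c /coord_vbasis -> /coord_vbasis -> /coord_vbasis ->.
  rewrite /tri (linear_sumlz smul) linear_sumlz big1 // => i _.
  rewrite (linear_sumr smul) linear_sumlz big1 // => j _.
  rewrite linear_sumr big1 // => k _.
  rewrite -/(tri _ _ _) !triE; have /forallP/(_ i)/forallP/(_ j)/forallP/(_ k) := t0.
  by move/eqP ->; rewrite !mulr0.
case/forallPn=> i /forallPn[j /forallPn[k tN0]].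
by right; exists (vbasis A)`_i, (vbasis B)`_j, (vbasis C)`_k; split.
Qed.

Lemma triPn (A : {vspace L}) x :
  ~ (forall a y, a \in A -> tri x a y = 0) ->
  exists a y, a \in A /\ tri x a y != 0.
Proof.
move=> nz; have [xA | [x' [a [y [/vlineP[c ->] aA _]]]]] := tri_dec <[x]> A fullv.
  by case: nz => a y aA; apply: xA => //; [apply: memv_line | apply: memvf].
by rewrite !triE mulf_eq0 negb_or => /andP[_ tN0]; exists a, y.
Qed.

End TripleProduct.

(** * Orthogonal subspaces *)
Section Orthogonality.
Variables (F : fieldType) (L : saa F).
Implicit Types (x y : L) (A B : {vspace L}).

Definition orth A : {vspace L} :=
  (\bigcap_(i < \dim A) lker (linfun (sform (vbasis A)`_i : L -> F^o)))%VS.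

Lemma orthP A x : reflect (forall a, a \in A -> sform x a = 0) (x \in orth A).
Proof.
apply: (iffP idP) => [xA a /coord_vbasis -> | xA].
  rewrite linear_sumr big1 // => i _; rewrite linearZr_LR /=.
  move: xA; rewrite memvE => /subv_bigcapP/(_ i isT); rewrite -memvE memv_ker.
  by rewrite lfunE /= sformC => /eqP ->; rewrite oppr0 mulr0.
rewrite memvE; apply/subv_bigcapP => i _; rewrite -memvE memv_ker lfunE /= sformC.
by rewrite xA ?oppr0 // vbasis_mem // mem_nth // size_tuple.
Qed.

Lemma orthS A B : (A <= B)%VS -> (orth B <= orth A)%VS.
Proof.
by move/subvP=> AB; apply/subvP => x /orthP xB; apply/orthP => a /AB /xB.
Qed.

(** Independence modulo [orth A] says that the Gram matrix of a basis of A
against the y i has full column rank; the rows of a left inverse give the dual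
vectors. *)
Lemma dual_family A k (y : 'I_k -> L) :
    (forall c : 'I_k -> F, \sum_i c i *: y i \in orth A -> forall i, c i = 0) ->
  exists x : 'I_k -> L,
    forall i, x i \in A /\ forall j, sform (x i) (y j) = (i == j)%:R.
Proof.
move=> indep; pose b := vbasis A.
pose G : 'M[F]_(\dim A, k) := \matrix_(a, j) sform b`_a (y j).
have rfG : row_full G.
  rewrite /row_full -mxrank_tr -/(row_free G^T).
  rewrite -kermx_eq0; apply/eqP/row_matrixP => i; rewrite row0.
  have := row_sub i (kermx G^T); move/sub_kermxP; set c := row i _ => cG.
  apply/rowP => j; rewrite [RHS]mxE; apply: (indep (fun j => c 0 j)); apply/orthP.
  move=> a /coord_vbasis ->; rewrite linear_sumr big1 // => l _.
  rewrite linearZr_LR /= sformC linear_sumr.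
  have /rowP/(_ l) := cG; rewrite !mxE => cGl.
  rewrite [X in - X](_ : _ = 0) ?oppr0 ?mulr0 // -[RHS]cGl.
  by apply: eq_bigr => t _; rewrite linearZr_LR !mxE.
have [X XG] := row_fullP rfG.
exists (fun i => \sum_a X i a *: b`_a) => i; split=> [|j].
  by apply: memv_suml => a _; rewrite memvZ // vbasis_mem // mem_nth // size_tuple.
have /matrixP/(_ i j) := XG; rewrite !mxE => <-.
rewrite linear_sumlz; apply: eq_bigr => a _.
by rewrite linearZl_LR !mxE.
Qed.

Lemma dual2 A y1 y2 :
    (forall a b, a *: y1 + b *: y2 \in orth A -> a = 0 /\ b = 0) ->
  exists x1 x2, [/\ x1 \in A, x2 \in A &
    [/\ sform x1 y1 = 1, sform x1 y2 = 0, sform x2 y1 = 0 & sform x2 y2 = 1]].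
Proof.
move=> indep; have [c|x xP] := @dual_family A _ (tnth [tuple y1; y2]).
  rewrite !big_ord_recl big_ord0 addr0 => /indep[c0 c1] i.
  case: i => -[|[|//]] lti; [rewrite -c0 | rewrite -c1];
    by congr (c _); apply/val_inj.
have [x0A x0] := xP 0; have [x1A x1] := xP 1.
by exists (x 0), (x 1); split=> //; split; rewrite ?(x0 0) ?(x0 1) ?(x1 0) ?(x1 1).
Qed.

Lemma dual3 A y1 y2 y3 :
    (forall a b c, a *: y1 + b *: y2 + c *: y3 \in orth A -> [/\ a = 0, b = 0 & c = 0]) ->
  exists x1 x2 x3, [/\ x1 \in A, x2 \in A & x3 \in A] /\
    [/\ [/\ sform x1 y1 = 1, sform x1 y2 = 0 & sform x1 y3 = 0],
        [/\ sform x2 y1 = 0, sform x2 y2 = 1 & sform x2 y3 = 0] &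
        [/\ sform x3 y1 = 0, sform x3 y2 = 0 & sform x3 y3 = 1]].
Proof.
move=> indep; have [c|x xP] := @dual_family A _ (tnth [tuple y1; y2; y3]).
  rewrite !big_ord_recl big_ord0 addr0 addrA => /indep[c0 c1 c2] i.
  case: i => -[|[|[|//]]] lti; [rewrite -c0 | rewrite -c1 | rewrite -c2];
    by congr (c _); apply/val_inj.
have [x0A x0] := xP 0; have [x1A x1] := xP 1; have [x2A x2] := xP 2%:R.
exists (x 0), (x 1), (x 2%:R); split=> //.
by split; split;
  rewrite ?(x0 0) ?(x0 1) ?(x0 2%:R) ?(x1 0) ?(x1 1) ?(x1 2%:R) ?(x2 0) ?(x2 1) ?(x2 2%:R).
Qed.

(** The orthogonal is the kernel of the map pairing with a basis of A, and this
map is onto because the basis has a dual family. *)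
Lemma dim_orth A : (\dim A + \dim (orth A) = \dim {:L})%N.
Proof.
pose b := vbasis A.
pose phi u : {ffun 'I_(\dim A) -> F^o} := [ffun i : 'I_(\dim A) => sform b`_i u].
have phi_lin : linear phi.
  by move=> a u v; apply/ffunP => i; rewrite !ffunE linearDr linearZr_LR.
pose h := GRing.isLinear.Build _ _ _ _ _ phi_lin.
pose f : {linear L -> {ffun 'I_(\dim A) -> F^o}} := HB.pack phi h.
have kerf : lker (linfun f) = orth A.
  apply/vspaceP => x; rewrite memv_ker lfunE; apply/eqP/orthP => [fx a | xA].
    move=> /coord_vbasis ->; rewrite linear_sumr big1 // => i _.
    have /ffunP/(_ i) := fx; rewrite !ffunE => fxi.
    by rewrite linearZr_LR /= sformC fxi oppr0 mulr0.
  apply/ffunP => i; rewrite !ffunE sformC xA ?oppr0 //.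
  by rewrite vbasis_mem // mem_nth // size_tuple.
have imf : limg (linfun f) = fullv.
  apply/vspaceP => w; rewrite memvf; apply/memv_imgP.
  have [c cP i | x xP] := @dual_family fullv _ (fun i : 'I_(\dim A) => b`_i).
    have /freeP := basis_free (vbasisP A); apply.
    apply: sform_nondeg => y; have /orthP := cP; apply; exact: memvf.
  exists (- \sum_i w i *: x i); first exact: memvf.
  apply/ffunP => j; rewrite lfunE ffunE sformC linearNl opprK linear_sumlz.
  rewrite (bigD1 j) //= big1 => [|i ij]; rewrite linearZl_LR (proj2 (xP _)) /=.
    by rewrite eqxx mulr1 addr0.
  by rewrite (negPf ij) mulr0.
have := limg_ker_dim (linfun f) fullv; rewrite capfv kerf imf => <-.
by rewrite addnC dimvf /dim /= muln1 card_ord.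
Qed.

Lemma orthK A : orth (orth A) = A.
Proof.
apply/eqP; rewrite eq_sym eqEdim; apply/andP; split.
  apply/subvP => x xA; apply/orthP => y /orthP yA.
  by rewrite sformC yA ?oppr0.
have dA := dim_orth A; have := dim_orth (orth A); rewrite -dA addnC.
by move/addIn ->.
Qed.

Lemma orth_le A B : (orth A <= orth B)%VS = (B <= A)%VS.
Proof. by apply/idP/idP => /orthS //; rewrite !orthK. Qed.

Lemma orthD A B : orth (A + B) = (orth A :&: orth B)%VS.
Proof.
apply/vspaceP => x; rewrite memv_cap; apply/orthP/andP => [xAB | [/orthP xA /orthP xB]].
  split; apply/orthP => a aA; apply: xAB.
    by apply: subvP aA; apply: addvSl.
  by apply: subvP aA; apply: addvSr.
by move=> _ /memv_addP[a aA [b bB ->]]; rewrite linearDr /= xA // xB // addr0.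
Qed.

End Orthogonality.

(** Vectors of B that are independent modulo A, as many as the codimension of A
in B, span B modulo A. *)
Lemma span_mod (F : fieldType) (V : vectType F) (A B : {vspace V}) k
    (v : 'I_k -> V) :
    (A <= B)%VS -> (forall i, v i \in B) -> (\dim B = \dim A + k)%N ->
    (forall c : 'I_k -> F, \sum_i c i *: v i \in A -> forall i, c i = 0) ->
  forall b, b \in B -> exists2 a, a \in A & exists c : 'I_k -> F, b = a + \sum_i c i *: v i.
Proof.
move=> AB vB dB indep b bB; pose X := [tuple v i | i < k].
have XE (i : 'I_k) : X`_i = v i by rewrite -tnth_nth tnth_mktuple.
have X0 (c : 'I_k -> F) : \sum_(i < k) c i *: X`_i = \sum_i c i *: v i.
  by apply: eq_bigr => i _; rewrite XE.
have Xfree : free X.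
  apply/freeP => c; rewrite X0 => c0 i; apply: indep i.
  by rewrite c0 mem0v.
have dX : \dim <<X>> = k by have := Xfree; rewrite /free => /eqP ->; rewrite size_tuple.
have AX0 : (A :&: <<X>> = 0)%VS.
  apply/eqP; rewrite -subv0; apply/subvP => x; rewrite memv_cap => /andP[xA xX].
  have := coord_span xX; rewrite X0 => xE; rewrite memv0 xE big1 // => i _.
  by rewrite (indep (fun i => coord X i x)) ?scale0r // -xE.
have AXB : (A + <<X>>)%VS = B.
  apply/eqP; rewrite eqEdim; apply/andP; split; last first.
    by rewrite (dimv_disjoint_sum AX0) dX dB.
  rewrite subv_add AB; apply/span_subvP => _ /mapP[i _ ->]; exact: vB.
move: bB; rewrite -AXB => /memv_addP[a aA [x xX ->]].
exists a => //; exists (fun i => coord X i x); rewrite -X0.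
by rewrite [in LHS](coord_span xX).
Qed.

Lemma span_mod3 (F : fieldType) (V : vectType F) (A B : {vspace V}) (u v w : V) :
    (A <= B)%VS -> u \in B -> v \in B -> w \in B -> (\dim B = \dim A + 3)%N ->
    (forall a b c, a *: u + b *: v + c *: w \in A -> [/\ a = 0, b = 0 & c = 0]) ->
  forall x, x \in B ->
  exists2 n, n \in A & exists a b c, x = n + (a *: u + b *: v + c *: w).
Proof.
move=> AB uB vB wB dB indep x xB.
pose f := tnth [tuple u; v; w].
have fE (c : 'I_3 -> F) : \sum_i c i *: f i = c 0 *: u + c 1 *: v + c 2%:R *: w.
  rewrite !big_ord_recl big_ord0 addr0 addrA.
  by congr (_ *: _ + _ *: _ + _ *: _); congr (c _); apply/val_inj.
have fB i : f i \in B by case: i => -[|[|[|//]]] ? /=.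
have [|n nA [c xE]] := span_mod AB fB dB _ xB; last first.
  by exists n => //; exists (c 0), (c 1), (c 2%:R); rewrite xE fE.
move=> c; rewrite fE => /indep[c0 c1 c2] i.
case: i => -[|[|[|//]]] lti; [rewrite -c0 | rewrite -c1 | rewrite -c2];
  by congr (c _); apply/val_inj.
Qed.

Lemma span_mod2 (F : fieldType) (V : vectType F) (A B : {vspace V}) (u v : V) :
    (A <= B)%VS -> u \in B -> v \in B -> (\dim B = \dim A + 2)%N ->
    (forall a b, a *: u + b *: v \in A -> a = 0 /\ b = 0) ->
  forall x, x \in B ->
  exists2 n, n \in A & exists a b, x = n + (a *: u + b *: v).
Proof.
move=> AB uB vB dB indep x xB.
pose f := tnth [tuple u; v].
have fE (c : 'I_2 -> F) : \sum_i c i *: f i = c 0 *: u + c 1 *: v.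
  rewrite !big_ord_recl big_ord0 addr0.
  by congr (_ *: _ + _ *: _); congr (c _); apply/val_inj.
have fB i : f i \in B by case: i => -[|[|//]] ? /=.
have [|n nA [c xE]] := span_mod AB fB dB _ xB; last first.
  by exists n => //; exists (c 0), (c 1); rewrite xE fE.
move=> c; rewrite fE => /indep[c0 c1] i.
by case: i => -[|[|//]] lti; [rewrite -c0 | rewrite -c1];
  congr (c _); apply/val_inj.
Qed.

(** * Standard bases and presentations *)
Section StandardBases.
Variables (F : fieldType) (n : nat).
Local Notation index := ('I_n + 'I_n)%type.

Definition conjugate (u : index) : index :=
  match u with inl i => inr i | inr i => inl i end.

Definition conjsign (u : index) : F := if u is inl _ then 1 else -1.

(** The form pairs each basis vector with its conjugate only; sign 1 when the
first argument is an x and -1 when it is a y. *)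
Definition gram (u v : index) : F := (u == conjugate v)%:R * conjsign u.

Lemma gramK u v : gram u (conjugate v) = (u == v)%:R * conjsign u.
Proof. by case: v. Qed.

Lemma conjsign_neq0 u : conjsign u != 0.
Proof. by case: u => i /=; rewrite ?oppr_eq0 oner_eq0. Qed.

Section Gram.
Variables (L : saa F) (e : index -> L).
Hypothesis xx : forall i j, sform (e (inl i)) (e (inl j)) = 0.
Hypothesis yy : forall i j, sform (e (inr i)) (e (inr j)) = 0.
Hypothesis xy : forall i j, sform (e (inl i)) (e (inr j)) = (i == j)%:R.

Lemma sform_gram u v : sform (e u) (e v) = gram u v.
Proof.
case: u v => i [] j; rewrite /gram /= ?xx ?yy.
- by rewrite mul0r.
- by rewrite xy mulr1.
- by rewrite sformC xy mulrN1 eq_sym.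
- by rewrite mul0r.
Qed.

(** Pairing a linear relation with the conjugate of one of its vectors isolates
one coefficient, so the vectors are independent, and the dimension does the
rest. *)
Lemma hyperbolic_standard_basis : \dim {:L} = (n + n)%N -> standard_basis e.
Proof.
move=> dL; split=> //.
rewrite basisEfree subvf size_codom card_sum !card_ord dL leqnn andbT.
have -> : codom e = codom_tuple e by [].
rewrite andbC /=; apply/freeP => c c0 i.
have := congr1 (fun v => sform v (e (conjugate (enum_val i)))) c0.
rewrite linear0l linear_sumlz (bigD1 i) //= big1 => [|j ji].
  rewrite nth_codom linearZl_LR sform_gram gramK eqxx mul1r addr0 => /eqP.
  by rewrite mulf_eq0 (negPf (conjsign_neq0 _)) orbF => /eqP.
rewrite nth_codom linearZl_LR sform_gram gramK (inj_eq enum_val_inj).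
by rewrite (negPf ji) mul0r mulr0.
Qed.

End Gram.

Lemma standard_basis_gram (L : saa F) (e : index -> L) :
  standard_basis e -> forall u v, sform (e u) (e v) = gram u v.
Proof. by case=> _; apply: sform_gram. Qed.

Lemma standard_basis_expand (L : saa F) (e : index -> L) x : standard_basis e ->
  exists c : index -> F, x = \sum_u c u *: e u.
Proof.
case=> eB _ _ _; have := memvf x; rewrite -(span_basis eB).
rewrite -[codom e]/(tval (codom_tuple e)) => /coord_span ->.
exists (fun u => coord (codom_tuple e) (enum_rank u) x).
rewrite [RHS](reindex (enum_val : 'I_#|{: index}| -> index)); last exact/onW_bij/enum_val_bij.
by apply: eq_bigr => i _; rewrite enum_valK nth_codom.
Qed.

End StandardBases.
Arguments gram {F n}.

Lemma perm_eq2 (T : eqType) (v w b c : T) :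
  perm_eq [:: v; w] [:: b; c] -> (v = b /\ w = c) \/ (v = c /\ w = b).
Proof.
move=> vw; have: v \in [:: b; c] by rewrite -(perm_mem vw) inE eqxx.
rewrite !inE => /orP[] /eqP vE; move: vw; rewrite vE.
  by rewrite perm_cons => /perm_small_eq -/(_ isT)[->]; left.
rewrite perm_sym -cat1s perm_catC /= perm_cons.
by move=> /perm_small_eq -/(_ isT)[->]; right.
Qed.

Lemma perm_eq3 (T : eqType) (u v w a b c : T) :
  perm_eq [:: u; v; w] [:: a; b; c] ->
  [:: u; v; w] \in [:: [:: a; b; c]; [:: a; c; b]; [:: b; a; c];
                       [:: b; c; a]; [:: c; a; b]; [:: c; b; a]].
Proof.
move=> uvw; have: u \in [:: a; b; c] by rewrite -(perm_mem uvw) inE eqxx.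
rewrite !inE => /or3P[] /eqP uE; move: uvw; rewrite uE.
- by rewrite perm_cons => /perm_eq2[] [-> ->]; rewrite eqxx ?orbT.
- rewrite perm_sym -(cat1s a) -(cat1s b) perm_catCA /= perm_cons perm_sym.
  by move=> /perm_eq2[] [-> ->]; rewrite eqxx ?orbT.
- rewrite perm_sym -[[:: a; b; c]]/([:: a; b] ++ [:: c]) perm_catC /= perm_cons perm_sym.
  by move=> /perm_eq2[] [-> ->]; rewrite eqxx ?orbT.
Qed.

(** The sign s depends on the permutation only. This uniformity in L and e is
what makes two algebras with the same presentation comparable. *)
Lemma tri_perm (F : fieldType) (I : eqType) (u v w a b c : I) :
  perm_eq [:: u; v; w] [:: a; b; c] ->
  exists s : F, forall (L : saa F) (e : I -> L),
    tri (e u) (e v) (e w) = s * tri (e a) (e b) (e c).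
Proof.
move/perm_eq3; rewrite !inE => /or4P[|||/or3P[]] /eqP[-> -> ->].
- by exists 1 => L e; rewrite mul1r.
- by exists (-1) => L e; rewrite mulN1r tri_swapr.
- by exists (-1) => L e; rewrite mulN1r tri_swap.
- by exists 1 => L e; rewrite mul1r -tri_cycle.
- by exists 1 => L e; rewrite mul1r tri_cycle.
- by exists (-1) => L e; rewrite mulN1r tri_swap -tri_cycle.
Qed.

Section PresentationUnique.
Variables (F : fieldType) (n : nat) (P : seq (('I_n + 'I_n) * ('I_n + 'I_n) * ('I_n + 'I_n))).
Variables (L M : saa F).

(** The linear map matching the two standard bases preserves the form and T on
basis vectors, hence everywhere; the product follows since the form is
nondegenerate and the map is onto. *)
Lemma presented_iso : presented_by L P -> presented_by M P -> saa_iso L M.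
Proof.
case=> e [eS e1 e0] [e' [eS' e1' e0']].
have dL : \dim {:L} = #|{: 'I_n + 'I_n}|.
  by have [eB _ _ _] := eS; have := size_basis (X := codom_tuple e) eB.
have dM : \dim {:M} = #|{: 'I_n + 'I_n}|.
  by have [eB _ _ _] := eS'; have := size_basis (X := codom_tuple e') eB.
have eqtri u v w : tri (e u) (e v) (e w) = tri (e' u) (e' v) (e' w).
  have [/hasP[[[a b] c] abcP /= uvw]|/hasPn uvw] := boolP (has (fun t =>
      perm_eq [:: u; v; w] [:: t.1.1; t.1.2; t.2]) P).
    have [s sE] := tri_perm F uvw.
    by rewrite !sE /tri e1 // e1'.
  by rewrite /tri e0 ?e0' // => a b c /uvw.
have [f fE] := linear_of_free (codom e) (codom e').
have fe u : f (e u) = e' u.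
  have [eB _ _ _] := eS; have := fE (basis_free eB).
  rewrite !size_codom => /(_ erefl); rewrite /codom /image_mem -map_comp.
  by move/eq_in_map; apply; rewrite mem_enum.
have fform u v : sform (f u) (f v) = sform u v.
  have [c ->] := standard_basis_expand u eS; have [d ->] := standard_basis_expand v eS.
  rewrite !(linear_sum f) !linear_sumlz; apply: eq_bigr => i _.
  rewrite !linear_sumr; apply: eq_bigr => j _.
  rewrite !(linearZ_LR f) /= !linearZl_LR !linearZr_LR !fe.
  by rewrite (standard_basis_gram eS) (standard_basis_gram eS').
have ker0 : lker (linfun f) == 0%VS.
  rewrite -subv0; apply/subvP => x; rewrite memv_ker lfunE memv0 /= => /eqP fx.
  by apply/eqP/sform_nondeg => y; rewrite -fform fx linear0l.
have imf : limg (linfun f) = fullv.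
  have cap0 : (fullv :&: lker (linfun f) = 0)%VS by rewrite (eqP ker0) capv0.
  by apply/eqP; rewrite eqEdim subvf (limg_dim_eq cap0) dM -dL leqnn.
have fK x : ((linfun f)^-1)%VF (f x) = x by rewrite -[f x]lfunE lker0_lfunK.
have Kf x : f (((linfun f)^-1)%VF x) = x.
  by rewrite -[f _]lfunE limg_lfunVK // imf memvf.
exists f; split=> //; first by exists (linfun f)^-1%VF.
have ftri u v w : tri (f u) (f v) (f w) = tri u v w.
  have [b ->] := standard_basis_expand u eS; have [c ->] := standard_basis_expand v eS.
  have [d ->] := standard_basis_expand w eS.
  rewrite !(linear_sum f) /tri !(linear_sumlz smul) !linear_sumlz; apply: eq_bigr => i _.
  rewrite !(linear_sumr smul) !linear_sumlz; apply: eq_bigr => j _.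
  rewrite !linear_sumr; apply: eq_bigr => k _.
  by rewrite !(linearZ_LR f) /= -!/(tri _ _ _) !triE !fe eqtri.
by move=> u v; apply: sform_eq => w; rewrite -[w]Kf fform; apply/esym/ftri.
Qed.

End PresentationUnique.

(** A linear order on the basis symbols: 0, ..., 4 stand for x_1, ..., x_5 and
5, ..., 9 for y_1, ..., y_5. *)
Definition idx (k : nat) : 'I_5 + 'I_5 := if (k < 5)%N then x_ k.+1 else y_ (k - 4).

Lemma idx_onto u : exists2 k, (k < 10)%N & u = idx k.
Proof.
case: u => i; [exists (i : nat) | exists (i + 5)%N] => //.
- by rewrite (ltn_trans (ltn_ord i)).
- by rewrite /idx ltn_ord /x_ /= inord_val.
- by rewrite (ltn_add2r 5 i 5).
- by rewrite /idx ltnNge leq_addl /= /y_ -addnBA //= addn1 inord_val.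
Qed.

Lemma idx_sorted u v w : exists i j k, [/\ (i <= j <= k)%N, (k < 10)%N &
  perm_eq [:: u; v; w] [:: idx i; idx j; idx k]].
Proof.
have [i i10 ->] := idx_onto u; have [j j10 ->] := idx_onto v.
have [k k10 ->] := idx_onto w.
have srt := sort_sorted leq_total [:: i; j; k].
have prm : perm_eq (sort leq [:: i; j; k]) [:: i; j; k] by rewrite perm_sort.
case: (sort _ _) srt prm => [|i' [|j' [|k' [|? ?]]]] //=;
  try by move=> _ /perm_size.
rewrite andbT => srt prm; exists i', j', k'; split=> //.
  have: k' \in [:: i; j; k] by rewrite -(perm_mem prm) !inE eqxx !orbT.
  by rewrite !inE => /or3P[] /eqP ->.
by have := perm_map idx prm; rewrite perm_sym.
Qed.

(* Indices below 10 in increasing order leave 120 triples; the order hypotheses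
   close every other branch. *)
Ltac enumerate_triples :=
  move=> [|[|[|[|[|[|[|[|[|?]]]]]]]]] [|[|[|[|[|[|[|[|[|?]]]]]]]]]
    [|[|[|[|[|[|[|[|[|[|?]]]]]]]]]] //.

Definition idx3 (t : nat * nat * nat) := (idx t.1.1, idx t.1.2, idx t.2).

(** The index triples of the three presentations. *)
Definition S1 : seq (nat * nat * nat) := [:: (0, 7, 9); (1, 8, 9); (5, 6, 9)]%N.
Definition S2 : seq (nat * nat * nat) :=
  [:: (1, 8, 9); (0, 7, 9); (5, 6, 9); (6, 7, 8)]%N.
Definition S3 : seq (nat * nat * nat) := [:: (1, 8, 9); (0, 7, 8); (5, 6, 9)]%N.

(** By alternation T is determined by its values on increasing triples, which
leaves 120 values to check instead of 1000. *)
Lemma presented_by_sorted (F : fieldType) (L : saa F) (e : 'I_5 + 'I_5 -> L) S :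
    standard_basis e -> all (fun t => (t.1.1 < t.1.2 < t.2) && (t.2 < 10))%N S ->
    (forall i j k, (i < j < k)%N -> (k < 10)%N ->
       tri (e (idx i)) (e (idx j)) (e (idx k)) = ((i, j, k) \in S)%:R) ->
  presented_by L (map idx3 S).
Proof.
move=> eS /allP Ssort eT; exists e; split=> // u v w.
  case/mapP=> -[[i j] k] ijkS [-> -> ->].
  by have /andP[ijk k10] := Ssort _ ijkS; rewrite -/(tri _ _ _) eT // ijkS.
move=> uvwP; have [i [j [k [/andP[ij jk] k10 perm]]]] := idx_sorted u v w.
have [s sE] := tri_perm F perm; rewrite -/(tri _ _ _) sE.
move: ij jk; rewrite leq_eqVlt => /orP[/eqP ->|ij]; first by rewrite tri_alt mulr0.
rewrite leq_eqVlt => /orP[/eqP ->|jk]; first by rewrite tri_alt mulr0.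
rewrite eT ?ij //; have [ijkS|_] := boolP ((i, j, k) \in S); last by rewrite mulr0.
by have := uvwP _ _ _ (map_f idx3 ijkS); rewrite perm.
Qed.

(** * Lower central series and nilpotency *)
Section CentralSeries.
Variables (F : fieldType) (L : saa F).
Implicit Types (x y z a b : L) (A B : {vspace L}).

Lemma sprodvS A B : (A <= B)%VS -> (sprodv A fullv <= sprodv B fullv)%VS.
Proof.
move/subvP=> AB; apply/sprodvP => a y aA _.
exact: memv_smul (AB a aA) (memvf y).
Qed.

Lemma lcs_sub k : (lcs L k.+1 <= lcs L k)%VS.
Proof.
case: k => [|k]; first exact: subvf.
by elim: k => [|k IHk]; [apply: subvf | apply: sprodvS].
Qed.

Lemma memv_lcsS k a y : (0 < k)%N -> a \in lcs L k -> smul a y \in lcs L k.+1.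
Proof. by case: k => // k _ ak; apply: memv_smul (memvf _). Qed.

(** The orthogonal of L^(k+1) consists of the x whose products with L^k vanish,
because T(x,a,y) = (ay,x). *)
Lemma orth_lcsSP k x : (0 < k)%N ->
  reflect (forall a y, a \in lcs L k -> tri x a y = 0) (x \in orth (lcs L k.+1)).
Proof.
move=> k0; apply: (iffP (orthP _ _)) => [xk a y ak | xk].
  by rewrite tri_cycle /tri sformC xk ?oppr0 // memv_lcsS.
have /subvP sub: (lcs L k.+1 <= orth <[x]>)%VS.
  move: k0 xk; case: k => // k _ xk; apply/sprodvP => a y ak _.
  apply/orthP => _ /vlineP[c ->]; rewrite linearZr_LR /=.
  by rewrite -/(tri a y x) -tri_cycle xk ?mulr0.
by move=> w /sub/orthP wx; rewrite sformC wx ?oppr0 // memv_line.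
Qed.

Lemma orth_lcs2 : orth (lcs L 2) = centre L.
Proof.
have fP x := @orth_lcsSP 1 x isT.
apply/vspaceP => x; apply/(fP x)/centre_tri => x0 y z; last by rewrite x0.
exact/x0/memvf.
Qed.

(** Multiplying the inclusion by L removes the central part and gives
L^(k+1) <= L^(k+2). The series is then constant from there on. *)
Lemma lcs_stable k : nilpotent L -> (0 < k)%N ->
  (lcs L k <= lcs L k.+1 + centre L)%VS -> lcs L k.+1 = 0%VS.
Proof.
move=> [m Lm0] k0 /subvP stab.
have step : (lcs L k.+1 <= lcs L k.+2)%VS.
  case: k k0 stab => // k _ stab; apply/sprodvP => a y /stab.
  case/memv_addP=> b bk [z /centreP z0 ->] _.
  by rewrite linearDl z0 addr0; apply: memv_smul (memvf _).
have far j : (lcs L k.+1 <= lcs L (j + k).+1)%VS.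
  elim: j => [|j IHj]; first exact: subvv.
  by apply: subv_trans step _; rewrite addSn; apply: sprodvS.
apply/eqP; rewrite -subv0 -Lm0; apply: subv_trans (far m) _.
rewrite -addnS; elim: (k.+1) => [|j IHj]; first by rewrite addn0 subvv.
by apply: subv_trans IHj; rewrite addnS lcs_sub.
Qed.

End CentralSeries.

(** * Structure of the algebras in the class *)
Section ClassStructure.
Variables (F : fieldType) (L : saa F).
Hypothesis clL : in_class L.
Implicit Types (x y z : L).

Local Notation Z := (centre L).
Local Notation N := (lcs L 2).
Local Notation R := (lcs L 3).

Lemma orthZ : orth Z = N. Proof. by rewrite -orth_lcs2 orthK. Qed.

Lemma dimN : \dim N = 7.
Proof.
have [d10 _ _ d3 _] := clL; have := dim_orth Z.
by rewrite d10 d3 orthZ => /(@addnI 3 _ 7).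
Qed.

Lemma dim_orthR : \dim (orth R) = 5.
Proof.
have [d10 _ _ _ d5] := clL; have := dim_orth R.
by rewrite d10 d5 => /(@addnI 5 _ 5).
Qed.

Lemma ZleN : (Z <= N)%VS.
Proof.
have [_ _ iso _ _] := clL.
by rewrite -orthZ; apply/subvP => x xZ; apply/orthP => a; apply: iso.
Qed.

Lemma RleN : (R <= N)%VS. Proof. exact: lcs_sub. Qed.

Lemma sformZN z n : z \in Z -> n \in N -> sform z n = 0.
Proof. by rewrite -orth_lcs2 => /orthP; apply. Qed.

Lemma orthR_tri x : x \in orth R -> forall y n, n \in N -> tri x n y = 0.
Proof. by move/orth_lcsSP => xR y n nN; apply: xR. Qed.

(** Suppose x in [orth R] is outside N. Then T(x,a,b) <> 0 for some a, b, and
L = N + <x,a,b>. For z in [orth R] and N, subtracting the multiple of x with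
the same value on (a,b) leaves a central element, which lies in N; so does that
multiple of x, which is therefore 0, and z is central. Taking orthogonals of
[orth R :&: N <= Z] gives N <= R + Z, which nilpotency forbids. *)
Lemma orthR_leN : (orth R <= N)%VS.
Proof.
have [d10 nilL _ d3 d5] := clL.
apply/negP => /negP/subvPn[x /orthR_tri xR xN].
have xZ : x \notin Z by apply: contra xN; apply/subvP/ZleN.
have [a [b [_ c0]]] : exists a b, a \in fullv /\ tri x a b != 0.
  apply: triPn => x0; case/negP: xZ; apply/centre_tri => y z.
  by apply: x0; apply: memvf.
have LE : forall y, exists2 n, n \in N & exists i j k, y = n + (i *: x + j *: a + k *: b).
  move=> y; apply: (span_mod3 (subvf N)); rewrite ?memvf ?d10 ?dimN //.
  move=> i j k hN.
  have j0 : j = 0.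
    have := xR b _ hN; rewrite !triE !tri_alt !mulr0 add0r addr0 => /eqP.
    by rewrite mulf_eq0 (negPf c0) orbF => /eqP.
  have k0 : k = 0.
    have := xR a _ hN; rewrite !triE !tri_alt (tri_swapr x b a) !mulr0 !add0r => /eqP.
    by rewrite mulf_eq0 oppr_eq0 (negPf c0) orbF => /eqP.
  split=> //; apply/eqP; apply: contraR xN => i0.
  move: hN; rewrite j0 k0 !scale0r !addr0.
  by move/(memvZ i^-1); rewrite scalerA mulVf // scale1r.
have capZ : (orth R :&: N <= Z)%VS.
  apply/subvP => z; rewrite memv_cap => /andP[/orthR_tri zR zN].
  pose d := tri z a b / tri x a b; pose z' := z - d *: x.
  have z'R u v : u \in N -> tri z' u v = 0.
    by move=> uN; rewrite !triE xR // zR // mulr0 subrr.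
  have z'x v : tri z' x v = 0.
    by rewrite !triE tri_alt mulr0 subr0 tri_swap xR // oppr0.
  have z'ab : tri z' a b = 0.
    by rewrite !triE /d divfK // subrr.
  have z'Z : z' \in Z.
    clearbody z'; apply/centre_tri => u v.
    have [n nN [i [j [k ->]]]] := LE u; have [n' n'N [i' [j' [k' ->]]]] := LE v.
    have z'n w := z'R n w nN; have z'n' w := z'R n' w n'N.
    rewrite !triE !z'n !z'x !tri_alt (tri_swapr z' a n') (tri_swapr z' b n').
    by rewrite !z'n' (tri_swapr z' b x) (tri_swapr z' a x) !z'x (tri_swapr z' b a) z'ab
      !(oppr0, mulr0, addr0).
  have d0 : d = 0.
    apply/eqP; apply: contraR xN => dN0.
    have : d *: x \in N.
      have -> : d *: x = z - z' by rewrite /z' opprB addrC subrK.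
      by rewrite memvB // (subvP ZleN).
    by move/(memvZ d^-1); rewrite scalerA mulVf // scale1r.
  by move: z'Z; rewrite /z' d0 scale0r subr0.
have : (N <= R + Z)%VS.
  by rewrite -orth_le orthD orthZ orth_lcs2.
move/(lcs_stable (k := 2) nilL isT) => R0.
by move: d5; rewrite R0 dimv0.
Qed.

Lemma ZleR : (Z <= R)%VS.
Proof. by rewrite -orth_le orthZ orthR_leN. Qed.

(** If (p,q) <> 0 with p, q in R, then R = Z + <p,q>. As (py,p) = (qy,q) = 0,
right multiplication by y acts on R/Z as the scalar T(p,y,q)/(p,q). A nonzero
scalar would give R <= L^4 + Z, against nilpotency. So RL <= Z, and p is
orthogonal to R after all. *)
Lemma orthR : orth R = R.
Proof.
have [d10 nilL _ d3 d5] := clL; apply/eqP; rewrite eq_sym eqEdim d5 dim_orthR andbT.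
have ZN := sformZN.
have RN := subvP RleN.
apply/subvP => p pR; apply/orthP => q qR; apply/eqP/contraT => pq0.
have RE y : y \in R -> exists2 z, z \in Z & exists i j, y = z + (i *: p + j *: q).
  apply: (span_mod2 ZleR) => //; first by rewrite d3 d5.
  move=> i j hZ; split.
    have := ZN _ q hZ (RN _ qR); rewrite !sformE sform_alt /= mulr0 addr0 => /eqP.
    by rewrite mulf_eq0 (negPf pq0) orbF => /eqP.
  have := ZN _ p hZ (RN _ pR); rewrite !sformE sform_alt /= mulr0 add0r sformC.
  by move/eqP; rewrite mulf_eq0 oppr_eq0 (negPf pq0) orbF => /eqP.
have qp : sform q p = - sform p q by rewrite sformC.
have py y : exists2 z, z \in Z & smul p y = z + (tri p y q / sform p q) *: p.
  have [|z zZ [i [j E]]] := RE (smul p y).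
    exact: (subvP (lcs_sub L 3)) (memv_lcsS (k := 3) y isT pR).
  have := congr1 (fun v => sform v p) E; rewrite -/(tri p y p) tri_alt !sformE /=.
  rewrite (ZN z p zZ (RN _ pR)) sform_alt mulr0 !add0r qp => /esym/eqP.
  rewrite mulf_eq0 oppr_eq0 (negPf pq0) orbF => /eqP j0.
  exists z => //; move: E; rewrite j0 scale0r addr0 => E.
  by rewrite /tri E !sformE /= (ZN z q zZ (RN _ qR)) add0r mulfK.
have qy y : exists2 z, z \in Z & smul q y = z + (tri p y q / sform p q) *: q.
  have [|z zZ [i [j E]]] := RE (smul q y).
    exact: (subvP (lcs_sub L 3)) (memv_lcsS (k := 3) y isT qR).
  have := congr1 (fun v => sform v q) E; rewrite -/(tri q y q) tri_alt !sformE /=.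
  rewrite (ZN z q zZ (RN _ qR)) sform_alt mulr0 addr0 !add0r => /esym/eqP.
  rewrite mulf_eq0 (negPf pq0) orbF => /eqP i0.
  exists z => //; move: E; rewrite i0 scale0r add0r => E.
  have -> : tri p y q = - tri q y p by rewrite -tri_cycle tri_swapr tri_cycle.
  by rewrite /tri E !sformE /= (ZN z p zZ (RN _ pR)) add0r qp mulrN opprK mulfK.
have t0 y : tri p y q = 0.
  apply/eqP/contraT => t0.
  have tN0 : tri p y q / sform p q != 0 by rewrite mulf_neq0 ?invr_eq0.
  have pm r : r \in R -> (exists2 z, z \in Z & smul r y = z + (tri p y q / sform p q) *: r) ->
      r \in (lcs L 4 + Z)%VS.
    move=> rR [z zZ E]; set t := tri p y q / _ in tN0 E.
    have -> : r = t^-1 *: smul r y - t^-1 *: z.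
      by rewrite E scalerDr addrC addKr scalerA mulVf // scale1r.
    by rewrite memv_add ?memvN ?memvZ // memv_lcsS.
  have : (R <= lcs L 4 + Z)%VS.
    apply/subvP => r /RE[z zZ [i [j ->]]].
    rewrite rpredD ?(subvP (addvSr _ _) _ zZ) // rpredD // memvZ //; apply: pm => //.
  move/(lcs_stable (k := 3) nilL isT) => L40.
  have : (R <= Z)%VS.
    apply/subvP => r rR; apply/centreP => w; apply/eqP; rewrite -memv0 -L40.
    exact: memv_lcsS.
  by move/dimvS; rewrite d3 d5.
have RZ r y : r \in R -> smul r y \in Z.
  case/RE=> z /centreP zZ [i [j ->]].
  rewrite !linearDl !linearZl_LR zZ add0r /=.
  have [z1 z1Z ->] := py y; have [z2 z2Z ->] := qy y.
  by rewrite t0 mul0r !scale0r !addr0 rpredD // memvZ.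
have : p \in orth R.
  by apply/orth_lcsSP => // a y aN; rewrite tri_swapr /tri ZN ?oppr0 // RZ.
by move/orthP/(_ q qR)/eqP; rewrite (negPf pq0).
Qed.

Lemma tri_RN r n y : r \in R -> n \in N -> tri r n y = 0.
Proof. by rewrite -{1}orthR => /orthR_tri rR /rR. Qed.

(** The kernel of the linear form that T induces from N x N. *)
Definition H : {vspace L} := orth (sprodv N N).

Lemma memHP h : reflect (forall n n', n \in N -> n' \in N -> tri n n' h = 0) (h \in H).
Proof.
apply: (iffP (orthP _ _)) => [hH n n' nN n'N | hH w].
  by rewrite /tri sformC hH ?oppr0 // memv_smul.
have /subvP sub : (sprodv N N <= orth <[h]>)%VS.
  apply/sprodvP => n n' nN n'N; apply/orthP => _ /vlineP[c ->].
  by rewrite linearZr_LR /= -/(tri n n' h) hH // mulr0.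
by move/sub/orthP => wh; rewrite sformC wh ?oppr0 // memv_line.
Qed.

Lemma tri_RN2 r y n : r \in R -> n \in N -> tri r y n = 0.
Proof. by move=> rR nN; rewrite tri_swapr tri_RN ?oppr0. Qed.

Lemma tri_NNH n n' h : n \in N -> n' \in N -> h \in H -> tri n n' h = 0.
Proof. by move=> nN n'N /memHP; apply. Qed.

Lemma tri_NHN n h n' : n \in N -> h \in H -> n' \in N -> tri n h n' = 0.
Proof. by move=> nN hH n'N; rewrite tri_swapr tri_NNH ?oppr0. Qed.

Lemma sformRR r r' : r \in R -> r' \in R -> sform r r' = 0.
Proof. by rewrite -{1}orthR => /orthP; apply. Qed.

Lemma exists_NNL : exists y1 y2 y5, [/\ y1 \in N, y2 \in N & tri y1 y2 y5 = 1].
Proof.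
have [d10 _ _ d3 d5] := clL.
have [t0 | [y1 [y2 [y5 [y1N y2N _ tN0]]]]] := tri_dec N N fullv; last first.
  exists y1, y2, ((tri y1 y2 y5)^-1 *: y5); split=> //.
  by rewrite triZr mulVf.
have : (N <= orth R)%VS.
  apply/subvP => n nN; apply/orth_lcsSP => // a y aN.
  exact: t0 nN aN (memvf y).
by move/dimvS; rewrite dimN dim_orthR.
Qed.

Lemma N_decomp y1 y2 n : y1 \in N -> y2 \in N ->
    (forall a b, a *: y1 + b *: y2 \in R -> a = 0 /\ b = 0) -> n \in N ->
  exists2 r, r \in R & exists a b, n = r + (a *: y1 + b *: y2).
Proof.
have [_ _ _ _ d5] := clL.
move=> y1N y2N indep; apply: span_mod2 => //; first exact: RleN.
by rewrite dimN d5.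
Qed.

Lemma indepR y1 y2 y5 : y1 \in N -> y2 \in N -> tri y1 y2 y5 = 1 ->
  forall a b, a *: y1 + b *: y2 \in R -> a = 0 /\ b = 0.
Proof.
move=> y1N y2N t1 a b hR; split.
  have := tri_RN y5 hR y2N.
  by rewrite !triE tri_alt t1 mulr1 mulr0 addr0.
have := tri_RN y5 hR y1N.
rewrite !triE tri_alt tri_swap t1 mulr0 add0r mulrN1 => /eqP.
by rewrite oppr_eq0 => /eqP.
Qed.

(** On N the form T factors through the plane N/R, where every alternating
trilinear form is zero. *)
Lemma NleH : (N <= H)%VS.
Proof.
have [y1 [y2 [y5 [y1N y2N t1]]]] := exists_NNL.
have dec n nN := @N_decomp y1 y2 n y1N y2N (indepR y1N y2N t1) nN.
apply/subvP => m mN; apply/memHP => n n' nN n'N.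
have [r rR [a [b nE]]] := dec n nN; have [r' r'R [a' [b' n'E]]] := dec n' n'N.
have [s sR [c [d mE]]] := dec m mN.
rewrite nE triDl tri_RN // add0r n'E triDm.
have RL u v : tri u r' v = - tri r' u v by rewrite tri_swap.
rewrite RL (tri_RN2 _ r'R mN) oppr0 add0r mE triDr -tri_cycle.
rewrite tri_RN //; last by rewrite rpredD // memvZ.
by rewrite add0r !triE !tri_alt !(mulr0, addr0).
Qed.

(** If i h + j h' + k y5 is in N, pairing it with (y1,y2) gives k = 0, and
then pairing with (n,h') and (n,h) gives i = j = 0. *)
Lemma L_decomp y1 y2 y5 n h h' : y1 \in N -> y2 \in N -> tri y1 y2 y5 = 1 ->
    n \in N -> h \in H -> h' \in H -> tri n h h' != 0 ->
  forall y, exists2 m, m \in N & exists i j k, y = m + (i *: h + j *: h' + k *: y5).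
Proof.
have [d10 _ _ _ _] := clL.
move=> y1N y2N t1 nN hH h'H tN0 y.
apply: (span_mod3 (subvf N)); rewrite ?memvf ?d10 ?dimN // => i j k hN.
have k0 : k = 0.
  have := tri_NNH y1N y2N (subvP NleH _ hN).
  by rewrite !triE t1 !(tri_NNH y1N y2N) // !mulr0 !add0r mulr1.
move: hN; rewrite k0 scale0r addr0 => hN; split=> //.
  have := tri_NNH nN hN h'H; rewrite !triE !tri_alt mulr0 addr0 => /eqP.
  by rewrite mulf_eq0 (negPf tN0) orbF => /eqP.
have := tri_NHN nN hH hN; rewrite !triE !tri_alt mulr0 add0r => /eqP.
by rewrite mulf_eq0 (negPf tN0) orbF => /eqP.
Qed.

(** H is the kernel of T(y1,y2,-), since y1 and y2 span N modulo R. *)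
Lemma H_decomp y1 y2 y5 : y1 \in N -> y2 \in N -> tri y1 y2 y5 = 1 ->
  forall y, exists2 h, h \in H & exists k, y = h + k *: y5.
Proof.
move=> y1N y2N t1 y.
exists (y - tri y1 y2 y *: y5); last by exists (tri y1 y2 y); rewrite subrK.
apply/memHP => n n' nN n'N.
have [r rR [a [b ->]]] := N_decomp y1N y2N (indepR y1N y2N t1) nN.
have [r' r'R [a' [b' n'E]]] := N_decomp y1N y2N (indepR y1N y2N t1) n'N.
rewrite triDl tri_RN // add0r n'E triDm tri_swap tri_RN ?rpredD ?memvZ //.
rewrite oppr0 add0r !triE !tri_alt (tri_swap y2 y1 y) (tri_swap y2 y1 y5) t1.
ring.
Qed.

(** The vectors of a standard basis up to central elements. Missing entries
read as 0: x_3, x_4, x_5 are to be taken in Z. *)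
Definition frame (xs ys : seq L) (u : 'I_5 + 'I_5) : L :=
  match u with inl i => nth 0 xs i | inr i => nth 0 ys i end.

Lemma frame_idx xs ys k : (k < 10)%N ->
  frame xs ys (idx k) = if (k < 5)%N then nth 0 xs k else nth 0 ys (k - 5).
Proof.
rewrite /idx; case: ifP => [k5|]; first by rewrite /= inordK.
move/negbT; rewrite -leqNgt /= => k5 k10.
by rewrite -subn1 -subnDA inordK // ltn_subLR.
Qed.

Lemma tri_modZ u v w u' v' w' : u - u' \in Z -> v - v' \in Z -> w - w' \in Z ->
  tri u v w = tri u' v' w'.
Proof.
have modl a a' b c : a - a' \in Z -> tri a b c = tri a' b c.
  by move=> /centre_tri aZ; rewrite -[a](subrK a') triDl aZ add0r.
move=> uZ vZ wZ; rewrite (modl _ _ _ _ uZ) tri_cycle (modl _ _ _ _ vZ).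
by rewrite tri_cycle (modl _ _ _ _ wZ) tri_cycle.
Qed.

(** Let x3, x4, x5 in Z be dual to y3, y4, y5. Adding combinations of them makes
x1, x2, y1, y2 orthogonal to y3, y4, y5 and makes y3, y4, y5 mutually
orthogonal; nothing else moves because Z is orthogonal to N. *)
Lemma lift_frame x1 x2 y1 y2 y3 y4 y5 :
    [/\ x1 \in N, x2 \in N, y1 \in N & y2 \in N] ->
    [/\ sform x1 y1 = 1, sform x1 y2 = 0, sform x2 y1 = 0 & sform x2 y2 = 1] ->
    sform x1 x2 = 0 -> sform y1 y2 = 0 ->
    (forall i j k, i *: y3 + j *: y4 + k *: y5 \in N -> [/\ i = 0, j = 0 & k = 0]) ->
  exists e : 'I_5 + 'I_5 -> L, standard_basis e /\
    forall u, e u - frame [:: x1; x2] [:: y1; y2; y3; y4; y5] u \in Z.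
Proof.
have [d10 _ _ _ _] := clL.
move=> [x1N x2N y1N y2N] [x1y1 x1y2 x2y1 x2y2] x1x2 y1y2.
rewrite -orthZ => /dual3[x3 [x4 [x5 [[x3Z x4Z x5Z]]]]].
move=> [[x33 x34 x35] [x43 x44 x45] [x53 x54 x55]].
pose pr w := w - (sform w y3 *: x3 + sform w y4 *: x4 + sform w y5 *: x5).
pose Y4 := y4 + sform y3 y4 *: x3.
pose Y5 := y5 + (sform y3 y5 *: x3 + sform y4 y5 *: x4).
have ZZ z z' : z \in Z -> z' \in Z -> sform z z' = 0.
  by move=> zZ z'Z; rewrite sformZN // (subvP ZleN).
have prN w w' : w \in N -> w' \in N -> sform (pr w) (pr w') = sform w w'.
  move=> wN w'N.
  have zN z : z \in Z -> (sform z w' = 0) * (sform w z = 0).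
    by move=> zZ; rewrite (sformC w) !sformZN ?oppr0.
  rewrite /pr !sformE /= !(zN _ x3Z, zN _ x4Z, zN _ x5Z).
  by rewrite !(ZZ _ _ x3Z, ZZ _ _ x4Z, ZZ _ _ x5Z) //; ring.
have prZ z w : z \in Z -> w \in N -> (sform z (pr w) = 0) * (sform (pr w) z = 0).
  move=> zZ wN.
  have -> : sform (pr w) z = - sform z (pr w) by rewrite sformC.
  have -> : sform z (pr w) = 0.
    rewrite /pr !sformE /= (sformZN zZ wN) !(ZZ _ _ zZ x3Z, ZZ _ _ zZ x4Z, ZZ _ _ zZ x5Z).
    by ring.
  by rewrite oppr0.
have pr3 w : sform (pr w) y3 = 0.
  by rewrite /pr !sformE /= x33 x43 x53; ring.
have pr4 w : w \in N -> sform (pr w) Y4 = 0.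
  move=> wN; rewrite /Y4 linearDr linearZr_LR /= (prZ _ _ x3Z wN) mulr0 addr0.
  by rewrite /pr !sformE /= x34 x44 x54; ring.
have pr5 w : w \in N -> sform (pr w) Y5 = 0.
  move=> wN; rewrite /Y5 !linearDr !linearZr_LR /=.
  rewrite (prZ _ _ x3Z wN) (prZ _ _ x4Z wN) !mulr0 !addr0.
  by rewrite /pr !sformE /= x35 x45 x55; ring.
have zY4 z : z \in Z -> sform z Y4 = sform z y4.
  by move=> zZ; rewrite /Y4 !sformE /= (ZZ _ _ zZ x3Z) mulr0 addr0.
have zY5 z : z \in Z -> sform z Y5 = sform z y5.
  by move=> zZ; rewrite /Y5 !sformE /= (ZZ _ _ zZ x3Z) (ZZ _ _ zZ x4Z) !mulr0 !addr0.
have y3x3 : sform y3 x3 = -1 by rewrite sformC x33.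
have y3x4 : sform y3 x4 = 0 by rewrite sformC x43 oppr0.
have y4x4 : sform y4 x4 = -1 by rewrite sformC x44.
have y4x3 : sform y4 x3 = 0 by rewrite sformC x34 oppr0.
have Y34 : sform y3 Y4 = 0 by rewrite /Y4 !sformE /= y3x3; ring.
have Y35 : sform y3 Y5 = 0 by rewrite /Y5 !sformE /= y3x3 y3x4; ring.
have Y45 : sform Y4 Y5 = 0.
  by rewrite {1}/Y4 linearDl linearZl_LR (zY5 _ x3Z) x35 /Y5 !sformE /= y4x3 y4x4; ring.
pose e := frame [:: pr x1; pr x2; x3; x4; x5] [:: pr y1; pr y2; y3; Y4; Y5].
exists e; split.
  have sC0 (u v : L) : sform u v = 0 -> sform v u = 0 by move=> uv; rewrite sformC uv oppr0.
  apply: hyperbolic_standard_basis; last exact: d10.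
  - by move=> -[[|[|[|[|[|//]]]]] ?] -[[|[|[|[|[|//]]]]] ?] /=;
      rewrite ?sform_alt ?prN ?prZ ?(ZZ _ _ x3Z, ZZ _ _ x4Z, ZZ _ _ x5Z) // ?(sC0 _ _ x1x2).
  - by move=> -[[|[|[|[|[|//]]]]] ?] -[[|[|[|[|[|//]]]]] ?] /=;
      rewrite ?sform_alt ?prN ?pr3 ?pr4 ?pr5 ?sform_alt //; apply: sC0;
      rewrite ?prN ?pr3 ?pr4 ?pr5.
  - by move=> -[[|[|[|[|[|//]]]]] ?] -[[|[|[|[|[|//]]]]] ?] /=;
      rewrite ?prN ?pr3 ?pr4 ?pr5 ?prZ ?zY4 ?zY5.
have prE w : w \in N -> pr w - w \in Z.
  by move=> wN; rewrite /pr addrC addKr rpredN !rpredD // memvZ.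
case=> -[[|[|[|[|[|//]]]]] ?] /=; rewrite ?subr0 ?subrr ?mem0v ?prE //.
  by rewrite /Y4 addrC addKr memvZ.
by rewrite /Y5 addrC addKr rpredD ?memvZ.
Qed.

(** The parameters (a,b,l) are (1,0,0), (1,0,1) and (0,1,0) for the three
presentations: b and l are the values of the linear form of the trichotomy at
x1 and y2. *)
Definition standard_values (a b l : F) (i j k : nat) : F :=
  match i, j, k with
  | 0, 7, 9 => a | 0, 7, 8 => b | 1, 8, 9 => 1 | 5, 6, 9 => 1 | 6, 7, 8 => l
  | _, _, _ => 0
  end.

Lemma tri_RmodN r u w u' w' : r \in R -> u - u' \in N -> w - w' \in N ->
  tri r u w = tri r u' w'.
Proof.
move=> rR uN wN; rewrite -[u](subrK u') triDm tri_RN // add0r.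
by rewrite -[w](subrK w') triDr tri_RN2 // add0r.
Qed.

Lemma tri_NmodN n u w u' w' : n \in N -> u' \in H -> w \in H ->
  u - u' \in N -> w - w' \in N -> tri n u w = tri n u' w'.
Proof.
move=> nN u'H wH uN wN; rewrite -[u](subrK u') triDm tri_NNH // add0r.
by rewrite -[w](subrK w') triDr tri_NHN // add0r.
Qed.

(** Adding to y3 and y4 combinations of y1 and y2 kills T(yi,y3,y5) and
T(yi,y4,y5) for i = 1, 2, because T(y1,y2,y5) = 1; a multiple of x2 added to y3
then kills T(y3,y4,y5). The values in the hypotheses survive because
T(R,N,L) = 0 and T(N,N,H) = 0. They also show that y3, y4, y5 are independent
modulo N, as [lift_frame] requires. *)
Lemma normal_basis x1 x2 y1 y2 y3 y4 y5 a b l :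
    [/\ x1 \in R, x2 \in R, y1 \in N & y2 \in N] -> y3 \in H -> y4 \in H ->
    [/\ sform x1 y1 = 1, sform x1 y2 = 0, sform x2 y1 = 0 & sform x2 y2 = 1] ->
    sform y1 y2 = 0 -> tri y1 y2 y5 = 1 ->
    [/\ tri x1 y3 y5 = a, tri x1 y4 y5 = 0, tri x2 y3 y5 = 0 & tri x2 y4 y5 = 1] ->
    [/\ tri x1 y3 y4 = b, tri x2 y3 y4 = 0, tri y1 y3 y4 = 0 & tri y2 y3 y4 = l] ->
    (a != 0) || (b != 0) ->
  exists e : 'I_5 + 'I_5 -> L, standard_basis e /\
    forall i j k, (i < j < k)%N -> (k < 10)%N ->
      tri (e (idx i)) (e (idx j)) (e (idx k)) = standard_values a b l i j k.
Proof.
move=> [x1R x2R y1N y2N] y3H y4H xy y1y2 t125 [t135 t145 t235 t245] [t134 t234 s134 s234] ab.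
have [x1N x2N] := (subvP RleN _ x1R, subvP RleN _ x2R).
pose w3 := y3 + tri y2 y3 y5 *: y1 - tri y1 y3 y5 *: y2.
pose v4 := y4 + tri y2 y4 y5 *: y1 - tri y1 y4 y5 *: y2.
pose v3 := w3 - tri w3 v4 y5 *: x2.
have v4N : v4 - y4 \in N by rewrite /v4 -(addrA y4) [X in X \in _]addrC addKr rpredB ?memvZ.
have w3N : w3 - y3 \in N by rewrite /w3 -(addrA y3) [X in X \in _]addrC addKr rpredB ?memvZ.
have v3N : v3 - y3 \in N by rewrite /v3 addrAC rpredB ?memvZ.
have v4H : v4 \in H by rewrite -(subrK y4 v4) rpredD // (subvP NleH).
have v3H : v3 \in H by rewrite -(subrK y3 v3) rpredD // (subvP NleH).
have yv4 : tri y1 v4 y5 = 0 /\ tri y2 v4 y5 = 0.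
  by rewrite /v4 !triE !tri_alt (tri_swap y2 y1) t125; split; ring.
have yw3 : tri y1 w3 y5 = 0 /\ tri y2 w3 y5 = 0.
  by rewrite /w3 !triE !tri_alt (tri_swap y2 y1) t125; split; ring.
have yv3 : tri y1 v3 y5 = 0 /\ tri y2 v3 y5 = 0.
  rewrite /v3 (triDm y1 w3) (triDm y2 w3) (proj1 yw3) (proj2 yw3) !triNm !triZm.
  rewrite (tri_swap y1 x2) (tri_swap y2 x2) !(tri_RN _ x2R) //.
  by rewrite oppr0 mulr0 oppr0 addr0.
have N55 : y5 - y5 \in N by rewrite subrr mem0v.
have v345 : tri v3 v4 y5 = 0.
  by rewrite /v3 (triDl w3) triNl triZl (tri_RmodN x2R v4N N55) t245 mulr1 subrr.
clearbody v3; clearbody v4.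
have [i j k hN|e [eS eZ]] := @lift_frame x1 x2 y1 y2 v3 v4 y5
  (And4 x1N x2N y1N y2N) xy (sformRR x1R x2R) y1y2.
  have k0 : k = 0.
    have := tri_NNH y1N y2N (subvP NleH _ hN).
    by rewrite !triE t125 !(tri_NNH y1N y2N) // !mulr0 !add0r mulr1.
  move: hN; rewrite k0 scale0r addr0 => hN.
  have j0 : j = 0.
    have := tri_RN y5 x2R hN; rewrite !triE (tri_RmodN x2R v3N N55) t235.
    by rewrite (tri_RmodN x2R v4N N55) t245 mulr0 add0r mulr1.
  move: hN; rewrite j0 scale0r addr0 => hN; split=> //.
  have ia : i * a = 0.
    by have := tri_RN y5 x1R hN; rewrite triZm (tri_RmodN x1R v3N N55) t135.
  have ib : i * b = 0.
    by have := tri_RN v4 x1R hN; rewrite triZm (tri_RmodN x1R v3N v4N) t134.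
  by case/orP: ab => [/mulIf|/mulIf]; apply; rewrite mul0r.
exists e; split=> // i j k /andP[ij jk] k10.
have j10 := ltn_trans jk k10; have i10 := ltn_trans ij j10.
rewrite (tri_modZ (eZ _) (eZ _) (eZ _)) !frame_idx //.
have zl u v : tri 0 u v = 0 by rewrite /tri !linear0l.
have zm u v : tri u 0 v = 0 by rewrite tri_swap zl oppr0.
have zr u v : tri u v 0 = 0 by rewrite -tri_cycle zl.
have RNx r y : r \in R -> (tri r x2 y = 0) * (tri r y1 y = 0) * (tri r y2 y = 0).
  by move=> rR; rewrite !tri_RN.
have RHH r : r \in R -> tri r v3 v4 = tri r y3 y4.
  by move=> rR; apply: tri_RmodN.
have RHL r : r \in R -> (tri r v3 y5 = tri r y3 y5) * (tri r v4 y5 = tri r y4 y5).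
  by move=> rR; split; apply: tri_RmodN.
have NHH n : n \in N -> tri n v3 v4 = tri n y3 y4.
  by move=> nN; apply: tri_NmodN.
have [[y1v4 y2v4] [y1v3 y2v3]] := (yv4, yv3).
move: i j k ij jk k10 {j10 i10}; enumerate_triples => _ _ _ /=; rewrite ?(zl, zm, zr) //;
  by rewrite ?(RNx _ _ x1R) ?(RNx _ _ x2R) ?(RHH _ x1R) ?(RHH _ x2R)
    ?(RHL _ x1R) ?(RHL _ x2R) ?(NHH _ y1N) ?(NHH _ y2N) ?(tri_NNH y1N y2N).
Qed.

Lemma R_dual y1 y2 y5 : y1 \in N -> y2 \in N -> tri y1 y2 y5 = 1 ->
  exists x1 x2, [/\ x1 \in R, x2 \in R &
    [/\ sform x1 y1 = 1, sform x1 y2 = 0, sform x2 y1 = 0 & sform x2 y2 = 1]].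
Proof.
by move=> y1N y2N t1; apply: dual2; rewrite orthR; apply: indepR t1.
Qed.

Lemma isotropic_correction y1 y2 y5 : y1 \in N -> y2 \in N -> tri y1 y2 y5 = 1 ->
  exists2 r, r \in R & sform (y1 + r) y2 = 0.
Proof.
move=> y1N y2N t1; have [x1 [x2 [_ x2R [_ _ _ x22]]]] := R_dual y1N y2N t1.
exists (- sform y1 y2 *: x2); first exact: memvZ.
by rewrite !sformE /= x22 mulr1 subrr.
Qed.

(** The value T(xi,u,y5) is the pairing of u with xi y5, so y3 and y4 form a
dual family in U to x1 y5 and x2 y5. The separation hypothesis makes these two
independent modulo [orth U]. *)
Lemma H_dual (U : {vspace L}) y1 y2 y5 :
    y1 \in N -> y2 \in N -> tri y1 y2 y5 = 1 ->
    (forall r, r \in R -> (forall u, u \in U -> tri r u y5 = 0) -> r \in Z) ->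
  exists x1 x2 y3 y4, [/\ x1 \in R, x2 \in R, y3 \in U & y4 \in U] /\
    [/\ sform x1 y1 = 1, sform x1 y2 = 0, sform x2 y1 = 0 & sform x2 y2 = 1] /\
    [/\ tri x1 y3 y5 = 1, tri x1 y4 y5 = 0, tri x2 y3 y5 = 0 & tri x2 y4 y5 = 1].
Proof.
move=> y1N y2N t1 sepU.
have [x1 [x2 [x1R x2R [x11 x12 x21 x22]]]] := R_dual y1N y2N t1.
have flip u x : sform u (smul x y5) = tri x u y5.
  by rewrite sformC -/(tri x y5 u) tri_swapr opprK.
have [i j ijU|y3 [y4 [y3U y4U [t13 t23 t14 t24]]]] :=
  @dual2 _ _ U (smul x1 y5) (smul x2 y5).
  have xZ : i *: x1 + j *: x2 \in Z.
    apply: sepU => [|u uU]; first by rewrite rpredD ?memvZ.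
    have := orthP _ _ ijU u uU; rewrite sformC => /eqP; rewrite oppr_eq0 => /eqP.
    by rewrite !sformE /= !flip !triE.
  have := sformZN xZ y1N; rewrite !sformE /= x11 x21 mulr1 mulr0 addr0 => ->.
  by have := sformZN xZ y2N; rewrite !sformE /= x12 x22 mulr1 mulr0 add0r.
exists x1, x2, y3, y4; split=> //; split=> //.
by rewrite -!flip.
Qed.

(** L = N + <h,h',y5> and T(x,N,L) = 0, so three values decide. *)
Lemma nullR_mem x y1 y2 y5 n h h' : y1 \in N -> y2 \in N -> tri y1 y2 y5 = 1 ->
    n \in N -> h \in H -> h' \in H -> tri n h h' != 0 ->
    x \in R -> tri x h h' = 0 -> tri x h y5 = 0 -> tri x h' y5 = 0 -> x \in Z.
Proof.
move=> y1N y2N t1 nN hH h'H tN0 xR xhh' xhy xh'y.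
have dec := L_decomp y1N y2N t1 nN hH h'H tN0.
apply/centre_tri => u v.
have [m mN [i [j [k ->]]]] := dec u; have [m' m'N [i' [j' [k' ->]]]] := dec v.
rewrite triDm tri_RN // add0r triDr tri_RN2 // add0r !triE !tri_alt xhh' xhy xh'y.
rewrite (tri_swapr x h' h) (tri_swapr x y5 h) (tri_swapr x y5 h') xhh' xhy xh'y.
by rewrite !oppr0 !(mulr0, addr0).
Qed.

(** The induced form on N is zero: dual vectors taken in H have all the required
values. *)
Lemma presented_by_NHH0 :
    (forall n h h', n \in N -> h \in H -> h' \in H -> tri n h h' = 0) ->
  presented_by L P10_3_1.
Proof.
move=> NHH0; have [z1 [y2 [y5 [z1N y2N tz]]]] := exists_NNL.
have [r rR y12] := isotropic_correction z1N y2N tz.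
have y1N : z1 + r \in N by rewrite rpredD // (subvP RleN).
have t1 : tri (z1 + r) y2 y5 = 1 by rewrite triDl tz tri_RN // addr0.
set y1 := z1 + r in y12 y1N t1.
have [x rx xU|x1 [x2 [y3 [y4 [[x1R x2R y3H y4H] [xy [t13 t14 t23 t24]]]]]]] :=
  @H_dual H _ _ _ y1N y2N t1.
  have xN := subvP RleN _ rx.
  apply/centre_tri => u v.
  have [h hH [k ->]] := H_decomp y1N y2N t1 u.
  have [h' h'H [k' ->]] := H_decomp y1N y2N t1 v.
  rewrite !triE NHH0 // xU // (tri_swapr x y5) xU // tri_alt; ring.
have [x1N x2N] := (subvP RleN _ x1R, subvP RleN _ x2R).
have [||e [eS eT]] := @normal_basis x1 x2 y1 y2 y3 y4 y5 1 0 0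
  (And4 x1R x2R y1N y2N) y3H y4H xy y12 t1 (And4 t13 t14 t23 t24).
- by split; rewrite NHH0.
- by rewrite oner_eq0.
apply: (presented_by_sorted (S := S1) eS) => //.
move=> i j k ijk k10; rewrite eT //.
by move: i j k ijk k10; enumerate_triples.
Qed.

(** T(-,h,h') is a nonzero linear form on the plane N/R: take y1 in its kernel
and scale y2. *)
Lemma adapted_NNL n h h' :
    (forall r, r \in R -> tri r h h' = 0) -> n \in N -> tri n h h' != 0 ->
  exists y1 y2 y5, [/\ y1 \in N, y2 \in N & tri y1 y2 y5 = 1] /\
    [/\ sform y1 y2 = 0, tri y1 h h' = 0 & tri y2 h h' = 1].
Proof.
move=> Rhh nN tN0; have [z1 [z2 [y5 [z1N z2N tz]]]] := exists_NNL.
suff [y1 [y2 [y1N y2N t1 t1h t2h]]] : exists y1 y2,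
    [/\ y1 \in N, y2 \in N, tri y1 y2 y5 = 1, tri y1 h h' = 0 & tri y2 h h' = 1].
  have [r rR y12] := isotropic_correction y1N y2N t1.
  have rN := subvP RleN _ rR.
  exists (y1 + r), y2, y5; split; split; rewrite ?rpredD // triDl.
    by rewrite t1 tri_RN ?addr0.
  by rewrite t1h Rhh ?addr0.
have [r rR [a [b nE]]] := N_decomp z1N z2N (indepR z1N z2N tz) nN.
have [z2h|z2h] := eqVneq (tri z2 h h') 0; last first.
  exists (tri z2 h h' *: z1 - tri z1 h h' *: z2), ((tri z2 h h')^-1 *: z2).
  split; rewrite ?(rpredB, memvZ) //.
  - by rewrite !triE !tri_alt tz; field.
  - by rewrite !triE mulrC subrr.
  - by rewrite triZl mulVf.
have z1h : tri z1 h h' != 0.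
  by move: tN0; rewrite nE !triE Rhh // z2h mulr0 addr0 add0r mulf_eq0 negb_or => /andP[].
exists (- tri z1 h h' *: z2), ((tri z1 h h')^-1 *: z1).
split; rewrite ?memvZ //.
- by rewrite !triE (tri_swap z2 z1) tz; field.
- by rewrite triZl z2h mulr0.
- by rewrite triZl mulVf.
Qed.

(** The induced form on N is zero on R but not on N. With y3, y4 in <h,h'> and
y1 in the kernel of T(-,h,h'), the only unwanted value is T(y2,y3,y4), which is
the determinant of (y3,y4) in terms of (h,h'). *)
Lemma presented_by_RHH0 n h h' : (forall r, r \in R -> tri r h h' = 0) ->
    n \in N -> h \in H -> h' \in H -> tri n h h' != 0 ->
  presented_by L P10_3_2.
Proof.
move=> Rhh nN hH h'H tN0.
have [y1 [y2 [y5 [[y1N y2N t1] [y12 t1h t2h]]]]] := adapted_NNL Rhh nN tN0.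
have [r rR rU|x1 [x2 [u3 [u4 [[x1R x2R]]]]]] := @H_dual (<[h]> + <[h']>)%VS _ _ _ y1N y2N t1.
  apply: (nullR_mem y1N y2N t1 nN hH h'H tN0 rR); rewrite ?Rhh // rU //.
    by apply: (subvP (addvSl _ _)); apply: memv_line.
  by apply: (subvP (addvSr _ _)); apply: memv_line.
move=> /memv_addP[_ /vlineP[a ->] [_ /vlineP[b ->] ->]].
move=> /memv_addP[_ /vlineP[c ->] [_ /vlineP[d ->] ->]] [[xy11 xy12 xy21 xy22]].
set y3 := a *: h + b *: h'; set y4 := c *: h + d *: h' => -[t13 t14 t23 t24].
have y3H : y3 \in H by rewrite rpredD ?memvZ.
have y4H : y4 \in H by rewrite rpredD ?memvZ.
have tri34 v : tri v y3 y4 = (a * d - b * c) * tri v h h'.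
  by rewrite /y3 /y4 !triE !tri_alt (tri_swapr v h' h); ring.
pose det := a * d - b * c.
(* The matrix of values T(xi,yj,y5) is the identity, and the coefficient matrix
   of (y3,y4) is a factor of it. *)
have det0 : det != 0.
  have := oner_neq0 F; apply: contraNneq => det0.
  have <- : det * (tri x1 h y5 * tri x2 h' y5 - tri x1 h' y5 * tri x2 h y5) = 1.
    transitivity (tri x1 y3 y5 * tri x2 y4 y5 - tri x1 y4 y5 * tri x2 y3 y5).
      by rewrite /y3 /y4 !triE /det; ring.
    by rewrite t13 t14 t23 t24; ring.
  by rewrite det0 mul0r.
clearbody y3 y4; pose s := det^-1.
(* This scaling multiplies T(y2,y3,y4) by the inverse of the determinant and
   keeps the values that are already 1. *)
have [|||||||||e [eS eT]] := @normal_basis (s *: x1) (det *: x2) (det *: y1) (s *: y2)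
  (det *: y3) (s *: y4) y5 1 0 1.
- by split; rewrite memvZ.
- by rewrite memvZ.
- by rewrite memvZ.
- by rewrite !sformE /= xy11 xy12 xy21 xy22 /s; split; field.
- by rewrite !sformE /= y12 !mulr0.
- by rewrite !triE t1 /s; field.
- by rewrite !triE t13 t14 t23 t24 /s; split; field.
- by rewrite !triE !tri34 -/det (Rhh _ x1R) (Rhh _ x2R) t1h t2h /s; split; field.
- by rewrite oner_eq0.
apply: (presented_by_sorted (S := S2) eS) => //.
move=> i j k ijk k10; rewrite eT //.
by move: i j k ijk k10; enumerate_triples.
Qed.

(** The induced form is nonzero on R: take x1 in R with value 1 and x2 in R,
not central, with value 0. Then y3, y4 in <h,h'> are adapted to T(x2,-,y5), the
vector y5 to x1, and y1, y2 come last as a family dual to x1, x2. *)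
Lemma presented_by_RHH r h h' : r \in R -> h \in H -> h' \in H -> tri r h h' != 0 ->
  presented_by L P10_3_3.
Proof.
have [d10 _ _ d3 d5] := clL.
move=> rR hH h'H tN0; have rN := subvP RleN _ rR.
have [z1 [z2 [z5 [z1N z2N tz]]]] := exists_NNL.
have [x2 [x2R x2Z x2h]] : exists x2, [/\ x2 \in R, x2 \notin Z & tri x2 h h' = 0].
  have : ~~ (R <= Z + <[r]>)%VS.
    apply/negP => /dimvS; rewrite d5 => le5.
    have := leq_trans le5 (dimv_add_leqif Z <[r]>%VS); rewrite d3 dim_vline.
    by case: (r != 0).
  case/subvPn=> x xR xZr; pose t := tri x h h' / tri r h h'.
  exists (x - t *: r); split; first by rewrite rpredB ?memvZ.
    apply: contra xZr => xZ; rewrite -[x](subrK (t *: r)).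
    by rewrite memv_add // memvZ // memv_line.
  by rewrite !triE /t divfK // subrr.
have [i [j ij1]] : exists i j, i * tri x2 h z5 + j * tri x2 h' z5 = 1.
  have [a0|a0] := eqVneq (tri x2 h z5) 0; last first.
    by exists (tri x2 h z5)^-1, 0; rewrite mulVf // mul0r addr0.
  have [b0|b0] := eqVneq (tri x2 h' z5) 0; last first.
    by exists 0, (tri x2 h' z5)^-1; rewrite mulVf // mul0r add0r.
  by case/negP: x2Z; apply: (nullR_mem z1N z2N tz rN hH h'H tN0 x2R x2h a0 b0).
(* y3 spans the kernel of T(x2,-,z5) on <h,h'>, and the coefficients are
   arranged so that (y3,y4) has determinant 1 with respect to (h,h'). *)
pose y3 := tri x2 h' z5 *: h - tri x2 h z5 *: h'; pose y4 := i *: h + j *: h'.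
have y3H : y3 \in H by rewrite rpredB ?memvZ.
have y4H : y4 \in H by rewrite rpredD ?memvZ.
have x2y3 : tri x2 y3 z5 = 0 by rewrite /y3 !triE; ring.
have x2y4 : tri x2 y4 z5 = 1 by rewrite /y4 !triE ij1.
have tri34 v : tri v y3 y4 = tri v h h'.
  rewrite -[RHS]mul1r -ij1 /y3 /y4 !triE !tri_alt (tri_swapr v h' h); ring.
pose x1 := (tri r h h')^-1 *: r.
have x1R : x1 \in R by rewrite memvZ.
have x134 : tri x1 y3 y4 = 1 by rewrite tri34 triZl mulVf.
have x234 : tri x2 y3 y4 = 0 by rewrite tri34.
have [x1N x2N] := (subvP RleN _ x1R, subvP RleN _ x2R).
clearbody y3 y4 x1.
(* Since T(x1,y3,y4) = 1, combinations of y3 and y4 added to z5 change the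
   values T(x1,y3,-) and T(x1,y4,-) at will. *)
pose y5 := z5 + (tri x1 y4 z5 *: y3 - tri x1 y3 z5 *: y4).
have x1y3 : tri x1 y3 y5 = 0 by rewrite /y5 !triE !tri_alt x134; ring.
have x1y4 : tri x1 y4 y5 = 0.
  by rewrite /y5 !triE !tri_alt (tri_swapr x1 y4 y3) x134; ring.
have {x2y3} x2y3 : tri x2 y3 y5 = 0 by rewrite /y5 !triE !tri_alt x234 x2y3; ring.
have {x2y4} x2y4 : tri x2 y4 y5 = 1.
  by rewrite /y5 !triE !tri_alt (tri_swapr x2 y4 y3) x234 x2y4; ring.
have tz' : tri z1 z2 y5 = 1.
  by rewrite /y5 !triE (tri_NNH z1N z2N y3H) (tri_NNH z1N z2N y4H) tz; ring.
clearbody y5.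
have [a b abZ|w1 [w2 [w1N w2N [w11 w12 w21 w22]]]] := @dual2 _ _ N x1 x2.
  move: abZ; rewrite orth_lcs2 => /centre_tri abZ.
  have := abZ y3 y4; rewrite !triE x134 x234 mulr0 addr0 mulr1 => ->.
  by have := abZ y4 y5; rewrite !triE x1y4 x2y4 mulr0 mulr1 add0r.
have [x1w1 x1w2] : sform x1 w1 = -1 /\ sform x1 w2 = 0.
  by rewrite sformC w11 sformC w21 oppr0.
have [x2w1 x2w2] : sform x2 w1 = 0 /\ sform x2 w2 = -1.
  by rewrite sformC w12 sformC w22 oppr0.
have x12 : sform x1 x2 = 0 by apply: sformRR.
have x21 : sform x2 x1 = 0 by apply: sformRR.
(* The signs turn (w,x) = 1 into (x,v) = 1. The multiple of x2 with coefficient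
   (w1,w2) makes v1 and v2 orthogonal; the other terms kill T(vi,y3,y4), with a
   symmetric coefficient matrix so that orthogonality survives. *)
pose v2 := - w2 + tri w2 y3 y4 *: x1.
pose v1 := - w1 - sform w1 w2 *: x2 + (tri w1 y3 y4 *: x1 + tri w2 y3 y4 *: x2).
have v1N : v1 \in N by rewrite !(rpredD, rpredN, memvZ).
have v2N : v2 \in N by rewrite !(rpredD, rpredN, memvZ).
have x1v1 : sform x1 v1 = 1 by rewrite /v1 !sformE /= sform_alt x12 x1w1; ring.
have x1v2 : sform x1 v2 = 0 by rewrite /v2 !sformE /= sform_alt x1w2; ring.
have x2v1 : sform x2 v1 = 0 by rewrite /v1 !sformE /= sform_alt x21 x2w1; ring.
have x2v2 : sform x2 v2 = 1 by rewrite /v2 !sformE /= x21 x2w2; ring.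
have v12 : sform v1 v2 = 0.
  by rewrite /v1 /v2 !sformE /= sform_alt x1w2 x2w2 x21 w11; ring.
have v134 : tri v1 y3 y4 = 0 by rewrite /v1 !triE x134 x234; ring.
have v234 : tri v2 y3 y4 = 0 by rewrite /v2 !triE x134; ring.
clearbody v1 v2.
pose om := tri v1 v2 y5.
(* v1 and v2 span N modulo R, where T(-,-,y5) is not zero. *)
have om0 : om != 0.
  have indep a b : a *: v1 + b *: v2 \in R -> a = 0 /\ b = 0.
    move=> abR; split.
      by have := sformRR x1R abR; rewrite !sformE /= x1v1 x1v2 mulr0 mulr1 addr0.
    by have := sformRR x2R abR; rewrite !sformE /= x2v1 x2v2 mulr0 mulr1 add0r.
  have [r1 r1R [a [b z1E]]] := N_decomp v1N v2N indep z1N.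
  have [r2 r2R [c [d z2E]]] := N_decomp v1N v2N indep z2N.
  have := oner_neq0 F; apply: contraNneq => om0; rewrite -tz'.
  rewrite z1E triDl tri_RN // add0r z2E triDm (tri_swap _ r2) tri_RN ?rpredD ?memvZ //.
  by rewrite oppr0 add0r !triE !tri_alt (tri_swap v2 v1) -/om om0; apply/eqP; ring.
have [|||||||||e [eS eT]] := @normal_basis (om *: x1) x2 (om^-1 *: v1) v2
  (om^-1 *: y3) y4 y5 0 1 0.
- by split; rewrite ?memvZ.
- by rewrite memvZ.
- by [].
- by rewrite !sformE /= x1v1 x1v2 x2v1 x2v2; split; field.
- by rewrite !sformE /= v12 mulr0.
- by rewrite !triE -/om mulVf.
- by rewrite !triE x1y3 x1y4 x2y3 x2y4; split; ring.
- by rewrite !triE x134 x234 v134 v234; split; field.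
- by rewrite oner_eq0 orbT.
apply: (presented_by_sorted (S := S3) eS) => //.
move=> i' j' k ijk k10; rewrite eT //.
by move: i' j' k ijk k10; enumerate_triples.
Qed.

Lemma class_presentations :
  [\/ presented_by L P10_3_1, presented_by L P10_3_2 | presented_by L P10_3_3].
Proof.
have [R0|[r [h [h' [rR hH h'H tN0]]]]] := tri_dec R H H; last first.
  by constructor 3; apply: presented_by_RHH rR hH h'H tN0.
have [N0|[n [h [h' [nN hH h'H tN0]]]]] := tri_dec N H H; last first.
  by constructor 2; apply: (presented_by_RHH0 _ nN hH h'H tN0) => r rR; apply: R0.
by constructor 1; apply: presented_by_NHH0.
Qed.

End ClassStructure.

(** * The algebra of a presentation *)
Section Model.
Variables (F : fieldType) (n : nat).
Local Notation index := ('I_n + 'I_n)%type.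
Variable P : seq (index * index * index).

Definition coords := {ffun index -> F^o}.
HB.instance Definition _ := Vector.on coords.
Implicit Types u v w : coords.

(** Coordinates with values in F itself rather than in its regular module. *)
Definition co u (a : index) : F := u a.

Lemma coP a u v (k : index) : co (a *: u + v) k = a * co u k + co v k.
Proof. by rewrite /co !ffunE. Qed.

Definition unit_coords (k : index) : coords := [ffun j => (j == k)%:R].

Lemma co_unit j k : co (unit_coords k) j = (j == k)%:R.
Proof. by rewrite /co ffunE. Qed.

Definition det3 (t : index * index * index) u v w : F :=
  let: (a, b, c) := t in
  co u a * (co v b * co w c - co v c * co w b)
  - co u b * (co v a * co w c - co v c * co w a)
  + co u c * (co v a * co w b - co v b * co w a).

Definition model_tri u v w : F := \sum_(t <- P) det3 t u v w.

Definition model_form u v : F :=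
  \sum_i (co u (inl i) * co v (inr i) - co u (inr i) * co v (inl i)).

(** The only product compatible with [model_form] and [model_tri]. *)
Definition model_mul u v : coords :=
  [ffun k => match k with
             | inl i => model_tri u v (unit_coords (inr i))
             | inr i => - model_tri u v (unit_coords (inl i))
             end].

Lemma model_form_bilinear : bilinear_for
  (GRing.Scale.Law.clone _ _ *%R _) (GRing.Scale.Law.clone _ _ *%R _) model_form.
Proof.
split=> [v|u] a x y /=; rewrite /model_form mulr_sumr -big_split /=;
  by apply: eq_bigr => i _; rewrite !coP; ring.
Qed.
HB.instance Definition _ := bilinear_isBilinear.Build F coords coords F _ _
  model_form model_form_bilinear.

Lemma model_triPl w v a x y :
  model_tri (a *: x + y) v w = a * model_tri x v w + model_tri y v w.
Proof.
rewrite /model_tri mulr_sumr -big_split /=.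
by apply: eq_bigr => -[[b c] d] _; rewrite /= !coP; ring.
Qed.

Lemma model_tri_swap u v w : model_tri u v w = - model_tri v u w.
Proof.
rewrite /model_tri -sumrN; apply: eq_bigr => -[[b c] d] _ /=; ring.
Qed.

Lemma model_tri_cycle u v w : model_tri u v w = model_tri v w u.
Proof. by rewrite /model_tri; apply: eq_bigr => -[[b c] d] _ /=; ring. Qed.

Lemma model_mul_bilinear : bilinear_for
  (GRing.Scale.Law.clone _ _ *:%R _) (GRing.Scale.Law.clone _ _ *:%R _) model_mul.
Proof.
have left v : linear (model_mul ^~ v).
  move=> a x y; apply/ffunP => -[] i; rewrite !ffunE /= model_triPl //.
  by rewrite opprD -mulrN.
have swap w w' : model_mul w w' = - model_mul w' w.
  by apply/ffunP => -[] i; rewrite !ffunE model_tri_swap.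
split=> // u a x y; rewrite /= swap left.
by rewrite (swap u x) (swap u y) scalerN opprD.
Qed.
HB.instance Definition _ := bilinear_isBilinear.Build F coords coords coords _ _
  model_mul model_mul_bilinear.

Lemma model_form_alt u : model_form u u = 0.
Proof. by rewrite /model_form big1 // => i _; ring. Qed.

Lemma model_form_unit u k :
  model_form u (unit_coords k) =
  match k with inl i => - co u (inr i) | inr i => co u (inl i) end.
Proof.
rewrite /model_form; case: k => i; rewrite (bigD1 i) //= big1 => [|j ji];
  rewrite !co_unit ?eqxx /=.
- by rewrite mulr0 mulr1 add0r addr0.
- by rewrite (_ : (inl j == inl i :> index) = (j == i)) // (negPf ji) !mulr0 subr0.
- by rewrite mulr0 mulr1 subr0 addr0.
- by rewrite (_ : (inr j == inr i :> index) = (j == i)) // (negPf ji) !mulr0 subr0.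
Qed.

Lemma model_form_nondeg u : (forall v, model_form u v = 0) -> u = 0.
Proof.
move=> u0; apply/ffunP => -[] i; rewrite ffunE.
  by have := u0 (unit_coords (inr i)); rewrite model_form_unit.
have := u0 (unit_coords (inl i)); rewrite model_form_unit => /eqP.
by rewrite oppr_eq0 => /eqP.
Qed.

Lemma model_mul_alt u : model_mul u u = 0.
Proof.
have t0 w : model_tri u u w = 0.
  by rewrite /model_tri big1 // => -[[b c] d] _ /=; ring.
by apply/ffunP => -[] i; rewrite !ffunE t0 ?oppr0.
Qed.

Lemma coords_expand w : w = \sum_k co w k *: unit_coords k.
Proof.
apply/ffunP => j; rewrite sum_ffunE (bigD1 j) //= big1 => [|k kj].
  by rewrite !ffunE eqxx addr0 -[RHS]/(w j * 1) mulr1.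
by rewrite !ffunE eq_sym (negPf kj); apply: mulr0.
Qed.

Lemma model_triE u v w : model_form (model_mul u v) w = model_tri u v w.
Proof.
have tri_linear : linear (model_tri u v : coords -> F^o).
  move=> a x y; rewrite !(model_tri_cycle u v) !(model_tri_cycle v).
  by rewrite !(model_tri_cycle _ u v) -!(model_tri_cycle _ u v) model_triPl.
pose h := GRing.isLinear.Build _ _ _ _ _ tri_linear.
pose f : {linear coords -> F^o} := HB.pack (model_tri u v : coords -> F^o) h.
have triZ c x : model_tri u v (c *: x) = c * model_tri u v x.
  exact: linearZ_LR f c x.
have tri_sum (E : index -> coords) :
    model_tri u v (\sum_k E k) = \sum_k model_tri u v (E k).
  exact: (linear_sum f).
rewrite [in RHS](coords_expand w) tri_sum big_sumType /= -big_split /=.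
by apply: eq_bigr => i _; rewrite !triZ /co !ffunE; ring.
Qed.

Lemma model_smul u v w :
  model_form (model_mul u v) w = model_form (model_mul v w) u.
Proof. by rewrite !model_triE model_tri_cycle. Qed.

Definition model : saa F :=
  @SAA F coords model_form model_mul model_form_alt model_form_nondeg
    model_mul_alt model_smul.

Lemma unit_standard_basis : @standard_basis F model n unit_coords.
Proof.
apply: hyperbolic_standard_basis => [i j|i j|i j|].
- by rewrite /= model_form_unit co_unit oppr0.
- by rewrite /= model_form_unit co_unit.
- by rewrite /= model_form_unit co_unit eq_sym.
- by rewrite dimvf /dim /= muln1 card_sum !card_ord.
Qed.

Lemma mem_span_units v (s : seq index) :
  reflect (forall k, k \notin s -> co v k = 0) (v \in <<map unit_coords s>>%VS).
Proof.
apply: (iffP idP) => [vs k ks | v0].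
  have /coord_span -> : v \in <<in_tuple (map unit_coords s)>>%VS by [].
  rewrite /co sum_ffunE big1 // => -[i /= lti] _.
  rewrite ffunE (nth_map k) ?ffunE; last by rewrite -(size_map unit_coords).
  rewrite (_ : k == _ = false) ?[_ *: _]mulr0 //; apply: contraNF ks => /eqP ->.
  by rewrite mem_nth // -(size_map unit_coords).
rewrite (coords_expand v); apply: memv_suml => k _; have [ks|ks] := boolP (k \in s).
  by rewrite memvZ // memv_span // map_f.
by rewrite v0 // scale0r mem0v.
Qed.

Lemma dim_span_units (s : seq index) : uniq s -> \dim <<map unit_coords s>> = size s.
Proof.
rewrite -(size_map unit_coords s) => us; apply/eqP; rewrite -[_ == _]/(free _).
elim: s us => [|k s IHs] /=; first by rewrite nil_free.
case/andP=> ks us; rewrite free_cons IHs // andbT.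
by apply/negP => /mem_span_units/(_ k ks)/eqP; rewrite co_unit eqxx oner_eq0.
Qed.

End Model.

Lemma idx_eq a b : (a < 10)%N -> (b < 10)%N -> (idx a == idx b) = (a == b).
Proof.
have inordE c : (c < 10)%N -> idx c = if (c < 5)%N then inl (inord c) else inr (inord (c - 5)).
  by move=> c10; rewrite /idx; case: ifP => // _; rewrite /y_ -subn1 -subnDA.
move=> a10 b10; apply/eqP/eqP => [|->//].
rewrite !inordE //; case: ltnP => a5; case: ltnP => b5 // -[] /(congr1 val) /=.
  by rewrite !inordK.
by rewrite !inordK ?ltn_subLR // => /(congr1 (addn^~ 5)) /=; rewrite !subnK.
Qed.

(** On unit vectors the minor of an increasing triple is 1 at that triple and 0
at every other increasing triple. *)
Lemma model_presented (F : fieldType) S :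
    uniq S -> all (fun t => (t.1.1 < t.1.2 < t.2) && (t.2 < 10))%N S ->
  presented_by (model F (map idx3 S)) (map idx3 S).
Proof.
move=> uS sS; apply: (presented_by_sorted (unit_standard_basis F (map idx3 S)) sS).
move=> i j k /andP[ij jk] k10; rewrite /tri /= model_triE /model_tri big_map.
have j10 := ltn_trans jk k10; have i10 := ltn_trans ij j10.
transitivity (\sum_(t <- S) (t == (i, j, k))%:R : F).
  rewrite !big_seq; apply: eq_bigr => -[[a b] c].
  move/(allP sS) => /= /andP[/andP[ab bc] c10].
  have b10 := ltn_trans bc c10; have a10 := ltn_trans ab b10.
  rewrite !co_unit !idx_eq // !xpair_eqE.
  have clash p q r t : (p < q)%N -> (r < t)%N -> (q == r)%:R * (p == t)%:R = 0 :> F.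
    move=> pq rt; rewrite -natrM mulnb; case: eqP => // qr; case: eqP => // pt.
    by have := ltn_trans pq (leq_ltn_trans (eq_leq qr) rt); rewrite pt ltnn.
  have ac := ltn_trans ab bc.
  rewrite (clash b c j k) // (clash a c j k) // (clash a b j k) // !subr0 !mulrA.
  rewrite (clash a b i j) // (clash a c i j) //.
  by rewrite !mul0r subr0 addr0 -!natrM !mulnb.
have [ijkS|ijkS] := boolP ((i, j, k) \in S).
  rewrite (bigD1_seq (i, j, k)) //= eqxx big1 ?addr0 // => t /negPf ->//.
rewrite big_seq big1 // => t tS; case: eqP => // tE.
by move: ijkS; rewrite -tE tS.
Qed.

Arguments idx : simpl never.

(** * The three models belong to the class *)
Section InClass.
Variables (F : fieldType) (S : seq (nat * nat * nat)).
Local Notation M := (model F (map idx3 S)).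
Local Notation T := (@model_tri F 5 (map idx3 S)).
Local Notation c_ k u := (co u (idx k)).
Local Notation unit k := (@unit_coords F 5 (idx k)).

Lemma co_smul_lo (u v : M) k : (k < 5)%N -> c_ k (smul u v) = T u v (unit (k + 5)).
Proof.
move=> k5; rewrite /co /= ffunE /idx k5 /x_ ltnNge leq_addl /=.
by rewrite /y_ -addnBA //= addn1.
Qed.

Lemma co_smul_hi (u v : M) k : (k < 5)%N -> c_ (k + 5) (smul u v) = - T u v (unit k).
Proof.
move=> k5; rewrite /co /= ffunE /idx k5 /x_ ltnNge leq_addl /=.
by rewrite /y_ -addnBA //= addn1.
Qed.

Definition spanU (ks : seq nat) : {vspace M} := <<map (@unit_coords F 5) (map idx ks)>>%VS.

Lemma mem_spanU (ks : seq nat) (u : M) : all (ltn^~ 10) ks ->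
  reflect (forall k, (k < 10)%N -> k \notin ks -> c_ k u = 0) (u \in spanU ks).
Proof.
move=> /allP ks10; apply: (iffP idP) => [/mem_span_units u0 k k10 kks | u0].
  apply: u0; apply: contra kks => /mapP[j jks /eqP].
  by rewrite idx_eq ?(ks10 j jks : (j < 10)%N) // => /eqP ->.
apply/mem_span_units => k; have [j j10 ->] := idx_onto k => jks; apply: u0 => //.
by apply: contra jks; apply: map_f.
Qed.

Lemma dim_spanU (ks : seq nat) : all (ltn^~ 10) ks -> uniq ks -> \dim (spanU ks) = size ks.
Proof.
move=> /allP ks10 uks; rewrite [LHS]dim_span_units ?size_map //.
rewrite map_inj_in_uniq // => a b /ks10 a10 /ks10 b10 /eqP.
by rewrite idx_eq // => /eqP.
Qed.

(* What the three models have in common: x3, x4, x5 span the radical of T,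
   products with elements of L^2 lie in the span of the x, and products with
   elements of that span are central. *)
Hypothesis central_T : forall u v w, c_ 0 u = 0 -> c_ 1 u = 0 -> c_ 5 u = 0 ->
  c_ 6 u = 0 -> c_ 7 u = 0 -> c_ 8 u = 0 -> c_ 9 u = 0 -> T u v w = 0.
Hypothesis radical_T : forall u, (forall v w, T u v w = 0) ->
  [/\ c_ 0 u = 0, c_ 1 u = 0, c_ 5 u = 0, c_ 6 u = 0 & [/\ c_ 7 u = 0, c_ 8 u = 0 & c_ 9 u = 0]].
Hypothesis second_T : forall u v, c_ 7 u = 0 -> c_ 8 u = 0 -> c_ 9 u = 0 ->
  T u v (unit 0) = 0 /\ T u v (unit 1) = 0.
Hypothesis third_T : forall u v, c_ 5 u = 0 -> c_ 6 u = 0 -> c_ 7 u = 0 ->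
  c_ 8 u = 0 -> c_ 9 u = 0 -> T u v (unit 5) = 0 /\ T u v (unit 6) = 0.
Hypothesis lcs3_units : forall k, (k < 5)%N -> (unit k : M) \in lcs M 3.

Lemma centre_model : centre M = spanU [:: 2; 3; 4]%N.
Proof.
apply/vspaceP => u; apply/centre_tri/mem_spanU => // [u0 | u0 v w].
  have [v w|c0 c1 c5 c6 [c7 c8 c9]] := @radical_T u.
    by have := u0 v w; rewrite /tri /= model_triE.
  by move=> [|[|[|[|[|[|[|[|[|[|k]]]]]]]]]].
by rewrite /tri /= model_triE central_T // u0.
Qed.

Lemma T_central u v k : (1 < k < 5)%N -> T u v (unit k) = 0.
Proof.
move=> /andP[k1 k5]; rewrite -model_tri_cycle central_T // co_unit idx_eq //;
  by [case: k k1 k5 => [|[|[|[|[|?]]]]]|apply: leq_trans k5 _].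
Qed.

Lemma co_derived u v :
  [/\ c_ 7 (smul u v : M) = 0, c_ 8 (smul u v : M) = 0 & c_ 9 (smul u v : M) = 0].
Proof.
by split; [rewrite (@co_smul_hi u v 2) | rewrite (@co_smul_hi u v 3)
  | rewrite (@co_smul_hi u v 4)]; rewrite ?T_central ?oppr0.
Qed.

Lemma lcs2_model : (lcs M 2 <= spanU (iota 0 7))%VS.
Proof.
apply/sprodvP => u v _ _; apply/mem_spanU => //; have [c7 c8 c9] := co_derived u v.
by move=> [|[|[|[|[|[|[|[|[|[|k]]]]]]]]]].
Qed.

Lemma lcs3_model : lcs M 3 = spanU (iota 0 5).
Proof.
apply/eqP; rewrite eqEsubv; apply/andP; split; last first.
  apply/span_subvP => _ /mapP[_ /mapP[k kS ->] ->]; apply: lcs3_units.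
  by move: kS; rewrite mem_iota.
apply/sprodvP => u v /(subvP lcs2_model)/mem_spanU u0 _; apply/mem_spanU => //.
have [t0 t1] : T u v (unit 0) = 0 /\ T u v (unit 1) = 0 by apply: second_T; apply: u0.
have [c7 c8 c9] := co_derived u v.
move=> [|[|[|[|[|[|[|[|[|[|k]]]]]]]]]] // _ _.
- by rewrite (@co_smul_hi u v 0) // t0 oppr0.
- by rewrite (@co_smul_hi u v 1) // t1 oppr0.
Qed.

Lemma lcs4_model : (lcs M 4 <= centre M)%VS.
Proof.
rewrite centre_model; apply/sprodvP => u v uR _.
have vN : smul u v \in lcs M 3 by exact: subvP (lcs_sub M 3) _ (@memv_lcsS _ M 3 u v isT uR).
have {uR} : u \in lcs M 3 by [].
move: vN; rewrite lcs3_model => /mem_spanU uv0 /mem_spanU u0; apply/mem_spanU => //.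
have [t0 t1] : T u v (unit 5) = 0 /\ T u v (unit 6) = 0 by apply: third_T; apply: u0.
move=> [|[|[|[|[|[|[|[|[|[|k]]]]]]]]]] // _ _; try exact: uv0.
- by rewrite co_smul_lo.
- by rewrite co_smul_lo.
Qed.

Lemma model_in_class : in_class M.
Proof.
split.
- by rewrite dimvf /dim /= muln1 card_sum !card_ord.
- exists 5; apply/eqP; rewrite -subv0; apply/sprodvP => u v uZ _.
  by have /centreP -> := subvP lcs4_model _ uZ; rewrite mem0v.
- move=> u v; rewrite centre_model => uZ vZ.
  rewrite /= /model_form big1 // => i _.
  have cy w : w \in spanU [:: 2; 3; 4]%N -> co w (inr i) = 0.
    have -> : inr i = idx (i + 5).
      by rewrite /idx ltnNge leq_addl /= /y_ -addnBA //= addn1 inord_val.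
    move/mem_spanU; apply => //; first by rewrite (ltn_add2r 5 i 5).
    by rewrite !inE !negb_or !neq_ltn; case: i => -[|[|[|[|[|]]]]].
  by rewrite (cy u uZ) (cy v vZ) mulr0 mul0r subrr.
- by rewrite centre_model dim_spanU.
- by rewrite lcs3_model dim_spanU.
Qed.

End InClass.

Section UnitProducts.
Variables (F : fieldType) (S : seq (nat * nat * nat)).
Local Notation M := (model F (map idx3 S)).
Local Notation T := (@model_tri F 5 (map idx3 S)).
Local Notation unit k := (@unit_coords F 5 (idx k)).

Lemma smul_lo (u v : M) k s : (k < 5)%N ->
  (forall w, T u v w = s * co w (idx (k + 5))) -> smul u v = s *: (unit k : M).
Proof.
move=> k5 tE; apply: sform_eq => w; rewrite linearZl_LR /= model_triE tE.
rewrite [model_form _ _](sformC (unit k : M) w) /= {2}/idx k5 model_form_unit.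
rewrite /idx ltnNge leq_addl /= /y_ -addnBA //= addn1 opprK.
by congr (_ * _).
Qed.

Lemma smul_hi (u v : M) k s : (k < 5)%N ->
  (forall w, T u v w = s * co w (idx k)) -> smul u v = - s *: (unit (k + 5) : M).
Proof.
move=> k5 tE; apply: sform_eq => w; rewrite linearZl_LR /= model_triE tE mulNr.
rewrite [model_form _ _](sformC (unit (k + 5) : M) w) /= mulrN opprK.
rewrite {2}/idx ltnNge leq_addl /= /y_ -addnBA //= addn1 model_form_unit.
by rewrite /idx k5.
Qed.

(** In turn: y1 and y2 are products up to sign, so they lie in L^2; multiplying
them by y5 gives x1 and x2, and these with y1 y2 give x3, x4, x5, up to sign.
Each hypothesis identifies one product. *)
Lemma lcs3_generated (u v t : M) :
    (forall w, T u v w = 1 * co w (idx 0)) ->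
    (forall w, T (unit 8) (unit 9) w = 1 * co w (idx 1)) ->
    (forall w, T (unit 6) (unit 9) w = 1 * co w (idx 5)) ->
    (forall w, T (unit 9) (unit 5) w = 1 * co w (idx 6)) ->
    (forall w, T (unit 0) t w = -1 * co w (idx 7)) ->
    (forall w, T (unit 1) (unit 9) w = -1 * co w (idx 8)) ->
    (forall w, T (unit 5) (unit 6) w = 1 * co w (idx 9)) ->
  forall k, (k < 5)%N -> (unit k : M) \in lcs M 3.
Proof.
move=> t0 t1 t5 t6 t7 t8 t9.
have scaled (V : {vspace M}) (x : M) (s : F) : s != 0 -> s *: x \in V -> x \in V.
  by move=> s0 /(memvZ s^-1); rewrite scalerA mulVf // scale1r.
have one0 : (1 : F) != 0 by rewrite oner_eq0.
have neg0 : (-1 : F) != 0 by rewrite oppr_eq0.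
have lcs_mul k (a b : M) : a \in lcs M k.+1 -> smul a b \in lcs M k.+2.
  exact: memv_lcsS.
have y1N : (unit 5 : M) \in lcs M 2.
  by apply: (scaled _ _ _ neg0); rewrite -(smul_hi (k := 0) isT t0) lcs_mul ?memvf.
have y2N : (unit 6 : M) \in lcs M 2.
  by apply: (scaled _ _ _ neg0); rewrite -(smul_hi (k := 1) isT t1) lcs_mul ?memvf.
have x1R : (unit 0 : M) \in lcs M 3.
  by apply: (scaled _ _ _ one0); rewrite -(smul_lo (k := 0) isT t5) lcs_mul.
have x2R : (unit 1 : M) \in lcs M 3.
  apply: (scaled _ _ _ one0); rewrite -(smul_lo (k := 1) isT t6).
  rewrite (_ : smul _ _ = - smul (unit 5 : M) (unit 9 : M)) ?memvN ?lcs_mul //.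
  by apply: sform_eq => w; rewrite linearNl -![sform _ _]/(tri _ _ _) tri_swap.
have RN := subvP (lcs_sub M 2).
case=> [|[|[|[|[|k]]]]] // _.
- by apply: (scaled _ _ _ neg0); rewrite -(smul_lo (k := 2) isT t7) lcs_mul // RN.
- by apply: (scaled _ _ _ neg0); rewrite -(smul_lo (k := 3) isT t8) lcs_mul // RN.
- by apply: (scaled _ _ _ one0); rewrite -(smul_lo (k := 4) isT t9) lcs_mul.
Qed.

End UnitProducts.

Ltac expand_tri :=
  rewrite /model_tri ?big_cons ?big_nil /= ?co_unit ?idx_eq //=.

(* Writes T as a polynomial in the coordinates and substitutes those known to
   vanish. *)
Ltac by_coordinates := intros; expand_tri;
  repeat match goal with E : co _ _ = 0 |- _ => rewrite ?E; clear E end; ring.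

Section ThreeModels.
Variable F : fieldType.
Local Notation unit k := (@unit_coords F 5 (idx k)).

Lemma central1 (u v w : coords F 5) : co u (idx 0) = 0 -> co u (idx 1) = 0 ->
  co u (idx 5) = 0 -> co u (idx 6) = 0 -> co u (idx 7) = 0 -> co u (idx 8) = 0 ->
  co u (idx 9) = 0 -> model_tri (map idx3 S1) u v w = 0.
Proof. by by_coordinates. Qed.

Lemma in_class1 : in_class (model F (map idx3 S1)).
Proof.
apply: model_in_class; try by split; by_coordinates.
- exact: central1.
- move=> u u0; split; last split.
  + by rewrite -[RHS](u0 (unit 7) (unit 9)); by_coordinates.
  + by rewrite -[RHS](u0 (unit 8) (unit 9)); by_coordinates.
  + by rewrite -[RHS](u0 (unit 6) (unit 9)); by_coordinates.
  + by rewrite -[RHS](u0 (unit 9) (unit 5)); by_coordinates.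
  + by rewrite -[RHS](u0 (unit 9) (unit 0)); by_coordinates.
  + by rewrite -[RHS](u0 (unit 9) (unit 1)); by_coordinates.
  + by rewrite -[RHS](u0 (unit 5) (unit 6)); by_coordinates.
- by apply: (lcs3_generated (u := unit 7) (v := unit 9) (t := unit 9)); by_coordinates.
Qed.

Lemma central2 (u v w : coords F 5) : co u (idx 0) = 0 -> co u (idx 1) = 0 ->
  co u (idx 5) = 0 -> co u (idx 6) = 0 -> co u (idx 7) = 0 -> co u (idx 8) = 0 ->
  co u (idx 9) = 0 -> model_tri (map idx3 S2) u v w = 0.
Proof. by by_coordinates. Qed.

Lemma in_class2 : in_class (model F (map idx3 S2)).
Proof.
apply: model_in_class; try by split; by_coordinates.
- exact: central2.
- move=> u u0; split; last split.
  + by rewrite -[RHS](u0 (unit 7) (unit 9)); by_coordinates.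
  + by rewrite -[RHS](u0 (unit 8) (unit 9)); by_coordinates.
  + by rewrite -[RHS](u0 (unit 6) (unit 9)); by_coordinates.
  + by rewrite -[RHS](u0 (unit 9) (unit 5)); by_coordinates.
  + by rewrite -[RHS](u0 (unit 9) (unit 0)); by_coordinates.
  + by rewrite -[RHS](u0 (unit 9) (unit 1)); by_coordinates.
  + by rewrite -[RHS](u0 (unit 5) (unit 6)); by_coordinates.
- by apply: (lcs3_generated (u := unit 7) (v := unit 9) (t := unit 9)); by_coordinates.
Qed.

Lemma central3 (u v w : coords F 5) : co u (idx 0) = 0 -> co u (idx 1) = 0 ->
  co u (idx 5) = 0 -> co u (idx 6) = 0 -> co u (idx 7) = 0 -> co u (idx 8) = 0 ->
  co u (idx 9) = 0 -> model_tri (map idx3 S3) u v w = 0.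
Proof. by by_coordinates. Qed.

Lemma in_class3 : in_class (model F (map idx3 S3)).
Proof.
apply: model_in_class; try by split; by_coordinates.
- exact: central3.
- move=> u u0; split; last split.
  + by rewrite -[RHS](u0 (unit 7) (unit 8)); by_coordinates.
  + by rewrite -[RHS](u0 (unit 8) (unit 9)); by_coordinates.
  + by rewrite -[RHS](u0 (unit 6) (unit 9)); by_coordinates.
  + by rewrite -[RHS](u0 (unit 9) (unit 5)); by_coordinates.
  + by rewrite -[RHS](u0 (unit 8) (unit 0)); by_coordinates.
  + by rewrite -[RHS](u0 (unit 9) (unit 1)); by_coordinates.
  + by rewrite -[RHS](u0 (unit 5) (unit 6)); by_coordinates.
- by apply: (lcs3_generated (u := unit 7) (v := unit 8) (t := unit 8)); by_coordinates.
Qed.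

End ThreeModels.

(** * The three models are not isomorphic *)
Section Invariants.
Variable F : fieldType.

(** Membership in H expressed with products, which span L^2, so that it is
visibly preserved by isomorphisms. *)
Definition kills_derived (L : saa F) (h : L) :=
  forall a b c d, tri h (smul a b) (smul c d) = 0.

Definition NHH0_inv (L : saa F) := forall h h' : L,
  kills_derived h -> kills_derived h' -> forall a b, tri h h' (smul a b) = 0.

Definition RHH0_inv (L : saa F) := forall h h' : L,
  kills_derived h -> kills_derived h' ->
  forall a b c, tri h h' (smul (smul a b) c) = 0.

Lemma iso_lift (L M : saa F) : saa_iso L M ->
  exists f : L -> M, exists g : M -> L, [/\ cancel g f,
    forall u v, f (smul u v) = smul (f u) (f v) &
    forall u v w, tri (f u) (f v) (f w) = tri u v w].
Proof.
case=> f [[g fK gK] form mul]; exists f, g; split=> // u v w.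
by rewrite /tri -mul form.
Qed.

Lemma kills_derived_iso (L M : saa F) (f : L -> M) (g : M -> L) h :
    cancel g f -> (forall u v, f (smul u v) = smul (f u) (f v)) ->
    (forall u v w, tri (f u) (f v) (f w) = tri u v w) ->
  kills_derived h -> kills_derived (g h).
Proof.
by move=> gK mul ftri hM a b c d; rewrite -ftri !mul gK.
Qed.

Lemma NHH0_inv_iso (L M : saa F) : saa_iso L M -> NHH0_inv L -> NHH0_inv M.
Proof.
move=> /iso_lift[f [g [gK mul ftri]]] invL h h' hM h'M a b.
have k := kills_derived_iso gK mul ftri.
have := invL _ _ (k _ hM) (k _ h'M) (g a) (g b).
by rewrite -ftri mul !gK.
Qed.

Lemma RHH0_inv_iso (L M : saa F) : saa_iso L M -> RHH0_inv L -> RHH0_inv M.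
Proof.
move=> /iso_lift[f [g [gK mul ftri]]] invL h h' hM h'M a b c.
have k := kills_derived_iso gK mul ftri.
have := invL _ _ (k _ hM) (k _ h'M) (g a) (g b) (g c).
by rewrite -ftri !mul !gK.
Qed.

Local Notation unit k := (@unit_coords F 5 (idx k)).
Local Notation M1 := (model F (map idx3 S1)).
Local Notation M2 := (model F (map idx3 S2)).
Local Notation M3 := (model F (map idx3 S3)).

(** The elements y1 and y2 of L^2 are products, up to sign, and T(h,y1,y2) is the
y5-coordinate of h. *)
Lemma kills_derived_co9 S (h : model F (map idx3 S)) :
    (forall w, model_tri (map idx3 S) (unit 7) (unit 9) w = 1 * co w (idx 0)) ->
    (forall w, model_tri (map idx3 S) (unit 8) (unit 9) w = 1 * co w (idx 1)) ->
    model_tri (map idx3 S) h (unit 5) (unit 6) = co h (idx 9) ->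
  kills_derived h -> co h (idx 9) = 0.
Proof.
move=> t0 t1 t9 /(_ (unit 7) (unit 9) (unit 8) (unit 9)).
rewrite (smul_hi (k := 0) isT t0) (smul_hi (k := 1) isT t1).
by rewrite triZm triZr /tri /= model_triE t9 !mulN1r opprK.
Qed.

Lemma kills1 (h : M1) : kills_derived h -> co h (idx 9) = 0.
Proof. by apply: kills_derived_co9; by_coordinates. Qed.

Lemma kills2 (h : M2) : kills_derived h -> co h (idx 9) = 0.
Proof. by apply: kills_derived_co9; by_coordinates. Qed.

Lemma model1_NHH0 : NHH0_inv M1.
Proof.
move=> h h' /kills1 h9 /kills1 h'9 a b.
have [n7 n8 n9] := co_derived (@central1 F) a b.
by rewrite /tri /= model_triE; by_coordinates.
Qed.

Lemma model2_RHH0 : RHH0_inv M2.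
Proof.
move=> h h' /kills2 h9 /kills2 h'9 a b c.
have co_N := co_derived (@central2 F).
have [m7 m8 m9] := co_N a b; have [n7 n8 n9] := co_N (smul a b) c.
have n5 : co (smul (smul a b) c) (idx 5) = 0.
  by rewrite (@co_smul_hi _ _ (smul a b) c 0) //; move: (smul a b) m7 m8 m9; by_coordinates.
have n6 : co (smul (smul a b) c) (idx 6) = 0.
  by rewrite (@co_smul_hi _ _ (smul a b) c 1) //; move: (smul a b) m7 m8 m9; by_coordinates.
by rewrite /tri /= model_triE; by_coordinates.
Qed.

(** Here y3, y4 are in H, and T(y3,y4,y2) = 1. *)
Lemma model2_not_NHH0 : ~ NHH0_inv M2.
Proof.
have co_N := co_derived (@central2 F).
have kill k : (k == 7) || (k == 8) -> kills_derived (unit k : M2).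
  move=> k78 a b c d; have [m7 m8 m9] := co_N a b; have [n7 n8 n9] := co_N c d.
  rewrite /tri /= model_triE.
  by case/orP: k78 => /eqP ->; by_coordinates.
move/(_ _ _ (kill 7 isT) (kill 8 isT) (unit 8) (unit 9)).
rewrite (smul_hi (k := 1) (s := 1)) //; last by by_coordinates.
rewrite triZr /tri /= model_triE => /eqP; rewrite mulN1r oppr_eq0 => /eqP t0.
have := oner_neq0 F.
rewrite -[X in X != 0](_ :
  @model_tri F 5 (map idx3 S2) (unit 7) (unit 8) (unit 6) = 1).
  by rewrite t0 eqxx.
by_coordinates.
Qed.

(** Here y3, y4 are in H, and T(y3,y4,x1) = 1 with x1 in L^3. *)
Lemma model3_not_RHH0 : ~ RHH0_inv M3.
Proof.
have co_N := co_derived (@central3 F).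
have kill k : (k == 7) || (k == 8) -> kills_derived (unit k : M3).
  move=> k78 a b c d; have [m7 m8 m9] := co_N a b; have [n7 n8 n9] := co_N c d.
  rewrite /tri /= model_triE.
  by case/orP: k78 => /eqP ->; by_coordinates.
move/(_ _ _ (kill 7 isT) (kill 8 isT) (unit 8) (unit 9) (unit 9)).
rewrite (smul_hi (u := unit 8) (v := unit 9) (k := 1) (s := 1)) //; last by by_coordinates.
rewrite linearZl_LR (smul_lo (k := 0) (s := 1)) //; last by by_coordinates.
rewrite scale1r triZr /tri /= model_triE => /eqP; rewrite mulN1r oppr_eq0 => /eqP t0.
have := oner_neq0 F.
rewrite -[X in X != 0](_ :
  @model_tri F 5 (map idx3 S3) (unit 7) (unit 8) (unit 0) = 1).
  by rewrite t0 eqxx.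
by_coordinates.
Qed.

End Invariants.

Theorem proposition4p5 (F : fieldType) :
  exists L1 L2 L3 : saa F,
  [/\ [/\ presented_by L1 P10_3_1, presented_by L2 P10_3_2
        & presented_by L3 P10_3_3],
      [/\ in_class L1, in_class L2 & in_class L3],
      [/\ ~ saa_iso L1 L2, ~ saa_iso L1 L3 & ~ saa_iso L2 L3]
    & forall L : saa F, in_class L ->
        [\/ saa_iso L L1, saa_iso L L2 | saa_iso L L3]].
Proof.
have pres1 : presented_by (model F (map idx3 S1)) P10_3_1.
  exact: (@model_presented F S1).
have pres2 : presented_by (model F (map idx3 S2)) P10_3_2.
  exact: (@model_presented F S2).
have pres3 : presented_by (model F (map idx3 S3)) P10_3_3.
  exact: (@model_presented F S3).
exists (model F (map idx3 S1)), (model F (map idx3 S2)), (model F (map idx3 S3)).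
split; first by split.
- by split; [apply: in_class1 | apply: in_class2 | apply: in_class3].
- split.
  + by move/NHH0_inv_iso/(_ (@model1_NHH0 F))/(@model2_not_NHH0 F).
  + move/RHH0_inv_iso => inv; apply: (@model3_not_RHH0 F); apply: inv.
    by move=> h h' hM h'M a b c; apply: model1_NHH0.
  + by move/RHH0_inv_iso/(_ (@model2_RHH0 F))/(@model3_not_RHH0 F).
move=> L /class_presentations[] presL.
- by constructor 1; apply: presented_iso presL pres1.
- by constructor 2; apply: presented_iso presL pres2.
- by constructor 3; apply: presented_iso presL pres3.
Qed.
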